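(* Let $p\ge 1$, $J=\{1,\dots,p\}$, $C=[0,1]^p$, and let $W=\{W(t):t\in C\}$ be a $p$-Brownian sheet on $C$ whose sample paths almost surely vanish on $\partial^-C$. Consider the (almost surely defined, unique) decomposition of the sample paths of $W$ as a sum of ramps, $$W(t)=\sum_{H\subset J}R_H(t),\qquad R_H(t)=\Big(\prod_{j\in J\setminus H}t_j\Big)T_H(t_H),\qquad t\in C,$$ where each $T_H$ is an $H$-tent. Then the processes $R_H$, $H\subset J$, are independent, and each $R_H$ is a Brownian $H$-ramp (that is, the corresponding $T_H$ is a Brownian $H$-tent).
   Context: A $p$-Brownian sheet on $C$ is a centred Gaussian process with covariances $\mathbf{E}\,W(s)W(t)=\prod_{j=1}^p(s_j\wedge t_j)$. $\partial^-C$ is the set of points of $C$ with at least one coordinate equal to $0$. For $H\subset J$ and $t\in C$, $t_H\in C$ is the point with $(t_H)_j=t_j$ if $j\in H$ and $(t_H)_j=1$ if $j\notin H$. Put $C_H=\{t_H:t\in C\}$ and $\partial_HC_H=\{t_H\in C_H: t_j=0\text{ or }t_j=1\text{ for some }j\in H\}$. An $H$-tent is a function $g_H:C_H\to\mathbb{R}$ vanishing on $\partial_HC_H$; its associated $H$-ramp is the function on $C$ given by $t\mapsto\big(\prod_{j\in J\setminus H}t_j\big)g_H(t_H)$ (empty products equal $1$). Every function $g:C\to\mathbb{R}$ vanishing on $\partial^-C$ has a unique decomposition $g=\sum_{H\subset J}R_H$ with each $R_H$ an $H$-ramp associated to an $H$-tent $T_H$; this is applied to the paths of $W$. A Brownian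 $H$-tent is a centred Gaussian process $T_H$ on $C_H$ with covariances $\mathbf{E}\,T_H(s)T_H(t)=\prod_{j\in H}(s_j\wedge t_j-s_jt_j)$; a Brownian $H$-ramp is the $H$-ramp associated to a Brownian $H$-tent. *)

(* Defs.v *)
From HB Require Import structures.
From mathcomp Require Import all_boot all_order all_algebra.
From mathcomp Require Import all_classical all_reals all_analysis.

Set Implicit Arguments.
Unset Strict Implicit.
Unset Printing Implicit Defensive.

Import Order.TTheory GRing.Theory Num.Theory.
Import numFieldNormedType.Exports.

Local Open Scope classical_set_scope.
Local Open Scope ring_scope.

(* A point of R^p is a function 'I_p -> R.  Functions and processes on the cube C
   or on its face C_H are total, and only their values on these sets are used. *)

Definition cube (R : realType) (p : nat) : set ('I_p -> R) :=
  [set t | forall j, 0 <= t j <= 1].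

Definition lower_boundary (R : realType) (p : nat) : set ('I_p -> R) :=
  [set t | cube t /\ exists j, t j = 0].

Definition face_proj (R : realType) (p : nat) (H : {set 'I_p})
    (t : 'I_p -> R) : 'I_p -> R :=
  fun j => if j \in H then t j else 1.

Definition face (R : realType) (p : nat) (H : {set 'I_p}) : set ('I_p -> R) :=
  face_proj H @` (@cube R p).

Definition face_boundary (R : realType) (p : nat) (H : {set 'I_p}) :
    set ('I_p -> R) :=
  [set t | face H t /\ exists2 j, j \in H & t j = 0 \/ t j = 1].

Definition is_tent (R : realType) (p : nat) (H : {set 'I_p})
    (g : ('I_p -> R) -> R) : Prop :=
  forall t, face_boundary H t -> g t = 0.

Definition ramp (R : realType) (p : nat) (H : {set 'I_p})
    (g : ('I_p -> R) -> R) : ('I_p -> R) -> R :=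
  fun t => (\prod_(j | j \notin H) t j) * g (face_proj H t).

Definition ramp_decomposition (R : realType) (p : nat)
    (g : ('I_p -> R) -> R) (T : {set 'I_p} -> ('I_p -> R) -> R) : Prop :=
  (forall H, is_tent H (T H)) /\
  (forall t, cube t -> g t = \sum_(H : {set 'I_p}) ramp H (T H) t).

Section Processes.
Context (d : measure_display) (Omega : measurableType d) (R : realType)
        (P : probability Omega R).

(* The degenerate laws are treated apart because [normal_prob m 0] is not the
   Dirac mass at m: in the library it is the uniform law on [0, 1]. *)
Definition gaussian_variable (Y : Omega -> R) : Prop :=
  exists m s : R, forall B : set R, measurable B ->
    P (Y @^-1` B) = if s == 0 then \d_m B else normal_prob m s B.

Definition gaussian_process (I : Type) (D : set I)
    (X : I -> {RV P >-> R}) : Prop :=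
  forall (n : nat) (t : 'I_n -> I) (a : 'I_n -> R), (forall i, D (t i)) ->
    gaussian_variable (fun w => \sum_(i < n) a i * X (t i) w).

Definition centred_gaussian_process (I : Type) (D : set I)
    (X : I -> {RV P >-> R}) : Prop :=
  gaussian_process D X /\ forall t, D t -> ('E_P[X t] = 0)%E.

Definition brownian_sheet (p : nat) (W : ('I_p -> R) -> {RV P >-> R}) : Prop :=
  centred_gaussian_process (@cube R p) W /\
  forall s t, cube s -> cube t ->
    ('E_P[fun w => (W s w * W t w)%R]
       = (\prod_(j < p) Num.min (s j) (t j))%R%:E)%E.

Definition brownian_tent (p : nat) (H : {set 'I_p})
    (T : ('I_p -> R) -> {RV P >-> R}) : Prop :=
  centred_gaussian_process (face H) T /\
  forall s t, face H s -> face H t ->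
    ('E_P[fun w => (T s w * T t w)%R]
       = (\prod_(j in H) (Num.min (s j) (t j) - s j * t j))%R%:E)%E.

(* "as" stands for "almost surely". *)
Definition as_ramp_decomposition (p : nat) (W : ('I_p -> R) -> Omega -> R)
    (T : {set 'I_p} -> ('I_p -> R) -> Omega -> R) : Prop :=
  {ae P, forall w,
    ramp_decomposition (fun t => W t w) (fun H t => T H t w)}.

Definition process_sigma_algebra (I : Type) (D : set I)
    (X : I -> Omega -> R) : set_system Omega :=
  <<s \bigcup_(t in D) preimage_set_system [set: Omega] (X t) measurable >>.

(* Mutual independence of the sigma-algebras generated by the processes. *)
Definition independent_processes (K : finType) (I : Type) (D : set I)
    (X : K -> I -> Omega -> R) : Prop :=
  forall (L : {set K}) (A : K -> set Omega),
    (forall k, k \in L -> process_sigma_algebra D (X k) (A k)) ->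
    P (\bigcap_(k in [set k | k \in L]) A k) = (\prod_(k in L) P (A k))%E.

End Processes.

(* Main.v *)
Require Import Defs.
From HB Require Import structures.
From mathcomp Require Import all_boot all_order all_algebra.
From mathcomp Require Import all_classical all_reals all_analysis.
From mathcomp Require Import measurable_realfun ring lra.

(** Every function [g] vanishing on the lower boundary has an explicit
    decomposition into ramps. In each direction [j], [g] is the sum of its linear
    part, [t j] times its value at [t j = 1], and of a remainder that vanishes at
    [t j = 0] and at [t j = 1]; expanding over all directions gives the H-tent
    [tent_of H g], a finite alternating sum of values of [g] at the points
    [face_proj K t] with [K \subset H]. Conversely [tent_of H] sends a K-ramp to
    its tent if [K = H] and to 0 otherwise ([tent_of_ramp]), which gives
    uniqueness. Applied to the paths of the sheet, this shows that the tents are,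
    up to almost sure equality, finite linear combinations of values of the sheet,
    hence jointly Gaussian and centred. Their covariances are sums over pairs of
    subsets of products over the coordinates, that is, products of sums over the
    coordinates; the factor of a coordinate that belongs to exactly one of [H] and
    [K] is 0, and the factor of a coordinate in both is
    [Num.min (s j) (t j) - s j * t j] ([sheet_tent_covariance]). So each tent is a
    Brownian tent, and tents with different indices are uncorrelated.

    It remains to see that jointly Gaussian, uncorrelated processes are
    independent. Let [phi] be the characteristic function of centred normal laws as
    a function of the standard deviation. The convolution of normal densities gives
    [phi r = phi s * phi t] when [r ^+ 2 = s ^+ 2 + t ^+ 2]
    ([normal_char_convolution]); therefore cosines of linear combinations of two
    uncorrelated blocks of variables satisfy the product rule ([uncorrelated_cos]).
    The passage from cosines to events ([trig_determination]) uses no density or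
    inversion formula: given a bounded variable [zeta] orthogonal to all cosines,
    the bounded functions that preserve this orthogonality under multiplication
    form an algebra that contains the cosines and is closed under bounded pointwise
    limits. By polynomial approximation of the sign function, it contains the signs
    of [sin ((X t - c) / n)], hence those of [X t - c], and so the indicators of all
    events generated by the process. *)

Set Implicit Arguments.
Unset Strict Implicit.
Unset Printing Implicit Defensive.

Import Order.TTheory GRing.Theory Num.Theory.
Import numFieldNormedType.Exports.

Local Open Scope classical_set_scope.
Local Open Scope ring_scope.

(** * Integrals against centred normal laws *)

Section NormalLaw.
Context {R : realType}.
Implicit Types (m s t b c x y : R) (f : R -> R).
Local Notation mu := (@lebesgue_measure R).

(** Integration against the normal law is integration against its density; the
    Radon-Nikodym derivative is almost everywhere equal to the density. *)
Lemma ge0_integral_normal_prob m s (f : R -> \bar R) :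
  measurable_fun setT f -> (forall x, 0 <= f x)%E ->
  (\int[normal_prob m s]_x f x =
   \int[mu]_x (f x * (normal_pdf m s x)%:E))%E.
Proof.
move=> mf f0.
have dom := normal_prob_dominates m s.
rewrite -(Radon_Nikodym_SigmaFinite.change_of_variables dom)//.
set g := Radon_Nikodym_SigmaFinite.f _ _.
have ig : mu.-integrable setT g := Radon_Nikodym_SigmaFinite.f_integrable dom.
have mp : measurable_fun setT (EFin \o normal_pdf m s).
  by apply/measurable_EFinP; exact: measurable_normal_pdf.
have gp : ae_eq mu setT g (EFin \o normal_pdf m s).
  apply: integral_ae_eq => //= E _ mE.
  by rewrite -Radon_Nikodym_SigmaFinite.f_integral.
apply: ae_eq_integral => //.
- by apply: emeasurable_funM => //; exact: measurable_int ig.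
- exact: emeasurable_funM.
by apply: filterS gp => x /= + _ => ->.
Qed.

Lemma ge0_integral_affine c b f : 0 < c -> continuous f ->
  (forall x, 0 <= f x) ->
  (\int[mu]_x (f (c * x + b) * c)%:E = \int[mu]_x (f x)%:E)%E.
Proof.
move=> c0 cf f0; pose F x := c * x + b.
have dF x : is_derive x 1 F c.
  rewrite /F; apply: is_derive_eq; by rewrite addr0 scaler1.
have F'E : derive1 F = cst c.
  by apply/funext => x; rewrite derive1E; exact: derive_val.
rewrite [RHS](@increasing_ge0_integration_by_substitutionT _ F)//.
- by apply: eq_integral => x _; rewrite F'E.
- by move=> x y xy; rewrite /F ltrD2r ltr_pM2l.
- by rewrite F'E => ?; exact: cvg_cst.
- by rewrite F'E; exact: is_cvg_cst.
- by rewrite F'E; exact: is_cvg_cst.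
- rewrite /F; apply: (@cvg_comp _ _ _ ( *%R c) (+%R^~ b) _ _ _);
    last exact: cvg_addrr_Ny.
  exact: gt0_cvgMrNy.
- rewrite /F; apply: (@cvg_comp _ _ _ ( *%R c) (+%R^~ b) _ _ _);
    last exact: cvg_addrr.
  exact: gt0_cvgMry.
Qed.

Lemma ge0_integral_reflect f : measurable_fun setT f -> (forall x, 0 <= f x) ->
  (\int[mu]_x (f (- x))%:E = \int[mu]_x (f x)%:E)%E.
Proof.
move=> mf f0; have mN : measurable_fun setT (-%R : R -> measurableTypeR R) by [].
transitivity (\int[pushforward mu (-%R : R -> measurableTypeR R)]_x (f x)%:E)%E.
  by rewrite ge0_integral_pushforward//; [exact/measurable_EFinP|move=> x _; rewrite lee_fin].
by apply: eq_measure_integral => //= A mA _; exact: lebesgue_measureN.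
Qed.

(** Completing the square: for r^2 = s^2 + t^2, the integrand of the convolution
    of N(0, s^2) and N(0, t^2) is the density of N(0, r^2) times a normal density
    in the other variable. *)
Lemma normal_pdf_convolution s t r x y : s != 0 -> t != 0 ->
  r ^+ 2 = s ^+ 2 + t ^+ 2 ->
  normal_pdf y s x * normal_pdf 0 t y =
  normal_pdf 0 r x * normal_pdf (t ^+ 2 * x / r ^+ 2) (s * t / r) y.
Proof.
move=> s0 t0 rE.
have s2 : 0 < s ^+ 2 by rewrite exprn_even_gt0.
have t2 : 0 < t ^+ 2 by rewrite exprn_even_gt0.
have r2 : 0 < r ^+ 2 by rewrite rE addr_gt0.
have r0 : r != 0 by apply: contraTneq r2 => ->; rewrite expr0n ltxx.
have q0 : s * t / r != 0 by rewrite mulf_neq0 ?invr_eq0 ?mulf_neq0.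
have pdfE m q z : q != 0 -> normal_pdf m q z = normal_peak q * normal_fun m q z.
  by move=> q1; rewrite normal_pdfE.
rewrite !pdfE//.
have peakE : normal_peak s * normal_peak t =
    normal_peak r * normal_peak (s * t / r).
  have h q : 0 <= q ^+ 2 * (pi : R) *+ 2.
    by rewrite mulrn_wge0// mulr_ge0 ?sqr_ge0 ?pi_ge0.
  rewrite /normal_peak -!invfM -!sqrtrM ?h//.
  congr (Num.sqrt _)^-1; field.
  by rewrite r0.
have funE : normal_fun y s x * normal_fun 0 t y =
    normal_fun 0 r x * normal_fun (t ^+ 2 * x / r ^+ 2) (s * t / r) y.
  rewrite /normal_fun -!expRD; congr expR.
  rewrite !subr0.
  have -> : (s * t / r) ^+ 2 = s ^+ 2 * t ^+ 2 / (s ^+ 2 + t ^+ 2).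
    by rewrite expr_div_n exprMn rE.
  rewrite rE; field.
  by rewrite s0 t0 -rE gt_eqF.
by rewrite mulrACA peakE funE mulrACA.
Qed.

(** The law N(0, s^2), which is the Dirac mass at 0 when [s = 0]; negative values
    of [s] are allowed. *)
Definition centred_normal s : probability (measurableTypeR R) R :=
  if s == 0 then [the probability _ _ of \d_(0 : measurableTypeR R)]
  else [the probability _ _ of normal_prob 0 s].

Lemma ge0_integral_centred_normal s (f : R -> \bar R) : s != 0 ->
  measurable_fun setT f -> (forall x, 0 <= f x)%E ->
  (\int[centred_normal s]_x f x =
   \int[mu]_x (f x * (normal_pdf 0 s x)%:E))%E.
Proof.
by move=> s0 mf f0; rewrite /centred_normal (negbTE s0) ge0_integral_normal_prob.
Qed.

Lemma integral_centred_normalN s (f : R -> \bar R) :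
  measurable_fun setT f -> (forall x, 0 <= f x)%E ->
  (\int[centred_normal (- s)]_x f x = \int[centred_normal s]_x f x)%E.
Proof.
move=> mf f0; have [->|s0] := eqVneq s 0; first by rewrite oppr0.
rewrite !ge0_integral_centred_normal ?oppr_eq0//; apply: eq_integral => x _.
by rewrite !normal_pdfE ?oppr_eq0// /normal_peak /normal_fun sqrrN.
Qed.

Lemma integral_centred_normal0 (f : R -> \bar R) : measurable_fun setT f ->
  (\int[centred_normal 0]_x f x = f 0%R)%E.
Proof.
by move=> mf; rewrite /centred_normal eqxx integral_dirac// diracT mul1e.
Qed.

Lemma integral_centred_normal_reflect s f : continuous f ->
  (forall x, 0 <= f x) ->
  (\int[centred_normal s]_x (f (- x))%:E = \int[centred_normal s]_x (f x)%:E)%E.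
Proof.
move=> cf f0; have mf := continuous_measurable_fun cf.
have mfN : measurable_fun setT (f \o -%R) by apply: measurableT_comp.
have [->|s0] := eqVneq s 0.
  rewrite !integral_centred_normal0 ?oppr0//; exact/measurable_EFinP.
rewrite !ge0_integral_centred_normal//; try exact/measurable_EFinP; last first.
  by move=> x; rewrite lee_fin.
under [RHS]eq_integral do rewrite -EFinM.
rewrite -[RHS]ge0_integral_reflect.
- apply: eq_integral => x _; rewrite -EFinM; congr (_ * _)%:E.
  by rewrite !normal_pdfE// /normal_fun !subr0 sqrrN.
- by apply: measurable_funM => //; exact: measurable_normal_pdf.
- by move=> x; rewrite mulr_ge0 ?normal_pdf_ge0.
Qed.

Lemma integral_centred_normal_sqr s :
  (\int[centred_normal s]_x (x ^+ 2)%:E =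
   (s ^+ 2)%:E * \int[centred_normal 1]_x (x ^+ 2)%:E)%E.
Proof.
have msq : measurable_fun [set: R] (fun x : R => x ^+ 2).
  exact: measurable_funX.
have [->|s0] := eqVneq s 0.
  rewrite integral_centred_normal0 ?expr0n ?mul0e//; exact/measurable_EFinP.
wlog s_gt0 : s s0 / 0 < s => [IH|].
  have := s0; rewrite neq_lt => /orP[s_lt0|/IH]; last exact.
  have sN0 : - s != 0 by rewrite oppr_eq0.
  have := IH (- s) sN0; rewrite sqrrN oppr_gt0 => /(_ s_lt0) <-.
  rewrite integral_centred_normalN//; first exact/measurable_EFinP.
  by move=> x; rewrite lee_fin sqr_ge0.
have sq0 (x : R) : (0 <= (x ^+ 2)%:E)%E by rewrite lee_fin sqr_ge0.
rewrite !ge0_integral_centred_normal ?oner_neq0//; try exact/measurable_EFinP.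
under eq_integral do rewrite -EFinM.
under [in RHS]eq_integral do rewrite -EFinM.
rewrite -(@ge0_integral_affine s 0)//.
- rewrite -ge0_integralZl//=.
  + apply: eq_integral => x _; rewrite -EFinM; congr (_%:E).
    rewrite !addr0 !normal_pdfE ?oner_neq0// /normal_peak /normal_fun !subr0.
    rewrite expr1n mul1r exprMn -mulrnAr sqrtrM ?sqr_ge0//.
    rewrite sqrtr_sqr gtr0_norm//.
    have -> : - (s ^+ 2 * x ^+ 2) / (s ^+ 2 *+ 2) = - x ^+ 2 / 2.
      by field.
    have : Num.sqrt ((pi : R) *+ 2) != 0.
      by rewrite gt_eqF// sqrtr_gt0 mulrn_wgt0 ?pi_gt0.
    by move=> ?; field; apply/andP.
  + apply/measurable_EFinP/measurable_funM => //; exact: measurable_normal_pdf.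
  + by move=> x _; rewrite lee_fin mulr_ge0 ?sqr_ge0 ?normal_pdf_ge0.
- move=> x; apply: (@continuousM _ _ (fun y : R => y ^+ 2)).
    exact: exprn_continuous.
  exact: continuous_normal_pdf.
- by move=> x; rewrite mulr_ge0 ?sqr_ge0 ?normal_pdf_ge0.
Qed.

(** N(0, s^2) and N(0, t^2) convolve to N(0, s^2 + t^2). *)
Lemma integral_centred_normal_convolution s t r f :
  r ^+ 2 = s ^+ 2 + t ^+ 2 -> continuous f -> (forall x, 0 <= f x) ->
  (\int[centred_normal t]_y (\int[centred_normal s]_x (f (x + y))%:E) =
   \int[centred_normal r]_x (f x)%:E)%E.
Proof.
move=> rE cf f0; have mf := continuous_measurable_fun cf.
have mEf : measurable_fun setT (EFin \o f) by exact/measurable_EFinP.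
have mfD y : measurable_fun setT (fun x => (f (x + y))%:E).
  by apply/measurable_EFinP/measurableT_comp => //; exact: measurable_funD.
have sqE u v : u ^+ 2 = v ^+ 2 ->
    (\int[centred_normal u]_x (f x)%:E = \int[centred_normal v]_x (f x)%:E)%E.
  move=> /eqP; rewrite eqf_sqr => /orP[/eqP->//|/eqP->].
  by rewrite integral_centred_normalN.
have [s0|s0] := eqVneq s 0.
  have E0 y : (\int[centred_normal s]_x (f (x + y))%:E = (f y)%:E)%E.
    by rewrite s0 integral_centred_normal0 ?add0r; last exact: mfD.
  under eq_integral do rewrite E0.
  by apply: sqE; rewrite rE s0 expr0n add0r.
have inner y : (\int[centred_normal s]_x (f (x + y))%:E =
    \int[mu]_x (f x * normal_pdf y s x)%:E)%E.
  rewrite ge0_integral_centred_normal//; last by move=> x; rewrite lee_fin.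
  rewrite -[RHS](@ge0_integral_affine 1 y)//.
  - apply: eq_integral => x _; rewrite -EFinM mulr1 mul1r; congr (_ * _)%:E.
    by rewrite !normal_pdfE// /normal_fun subr0 addrK.
  - move=> x; apply: continuousM; first exact: cf.
    exact: continuous_normal_pdf.
  - by move=> x; rewrite mulr_ge0 ?normal_pdf_ge0.
under eq_integral do rewrite inner.
have mp : measurable_fun [set: R * R] (fun z => f z.1 * normal_pdf z.2 s z.1).
  apply: measurable_funM; first exact: measurableT_comp.
  rewrite [X in measurable_fun _ X](_ : _ =
    fun z : R * R => normal_pdf 0 s (z.1 - z.2)); last first.
    by apply/funext => z; rewrite !normal_pdfE// /normal_fun subr0.
  apply: measurableT_comp; first exact: measurable_normal_pdf.
  exact: measurable_funB.
have mG := @measurable_fun_fubini_tonelli_G _ _ _ _ _ mu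
  (fun z : R * R => (f z.1 * normal_pdf z.2 s z.1)%:E).
have [t0|t0] := eqVneq t 0.
  rewrite t0 integral_centred_normal0//.
    rewrite -inner; under eq_integral do rewrite addr0.
    by apply: sqE; rewrite rE t0 expr0n addr0.
  apply: mG; first exact/measurable_EFinP.
  by move=> z; rewrite lee_fin mulr_ge0 ?normal_pdf_ge0.
have r0 : r != 0.
  by rewrite -sqrf_eq0 rE gt_eqF// addr_gt0// exprn_even_gt0.
rewrite [LHS]ge0_integral_centred_normal//; last 2 first.
- apply: mG; first exact/measurable_EFinP.
  by move=> z; rewrite lee_fin mulr_ge0 ?normal_pdf_ge0.
- move=> y; apply: integral_ge0 => x _.
  by rewrite lee_fin mulr_ge0 ?normal_pdf_ge0.
have H y : (\int[mu]_x (f x * normal_pdf y s x)%:E * (normal_pdf 0 t y)%:E =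
   \int[mu]_x (f x * normal_pdf y s x * normal_pdf 0 t y)%:E)%E.
  rewrite -ge0_integralZr//.
  - apply/measurable_EFinP/measurable_funM => //; exact: measurable_normal_pdf.
  - by move=> x _; rewrite lee_fin mulr_ge0 ?normal_pdf_ge0.
  - by rewrite lee_fin normal_pdf_ge0.
under eq_integral do rewrite H.
(* After the exchange of the integrals, the integral of the second factor of
   normal_pdf_convolution is 1. *)
rewrite -(fubini_tonelli (m1 := mu) (m2 := mu) 
  (fun z : R * R =>
    (f z.1 * normal_pdf z.2 s z.1 * normal_pdf 0 t z.2)%:E)); last 2 first.
- apply/measurable_EFinP/measurable_funM => //.
  by apply: measurableT_comp => //; exact: measurable_normal_pdf.
- by move=> z; rewrite lee_fin !mulr_ge0 ?normal_pdf_ge0.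
rewrite [RHS]ge0_integral_centred_normal//.
apply: eq_integral => x _ /=.
under eq_integral do
  rewrite -mulrA (normal_pdf_convolution _ _ s0 t0 rE) mulrA EFinM.
rewrite ge0_integralZl//=.
- by rewrite integral_normal_pdf mule1 EFinM.
- by apply/measurable_EFinP; exact: measurable_normal_pdf.
- by move=> y _; rewrite lee_fin normal_pdf_ge0.
- by rewrite lee_fin mulr_ge0 ?normal_pdf_ge0.
Qed.

End NormalLaw.

(** * Bounded variables *)

Section Bounded.
Context d (T : measurableType d) (R : realType) (P : probability T R).
Implicit Types (f g : T -> R).

(** Measurable functions bounded everywhere, which every probability integrates *)
Definition bounded_measurable f :=
  measurable_fun setT f /\ exists M : R, forall w, `|f w| <= M.

Lemma bounded_measurable_integrable f :
  bounded_measurable f -> P.-integrable setT (EFin \o f).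
Proof.
move=> [mf [M fM]]; apply: measurable_bounded_integrable => //.
  exact: (le_lt_trans (probability_le1 P measurableT) (ltry 1)).
exists M; split; first exact: num_real.
by move=> x Mx w _ /=; rewrite (le_trans (fM w))// ltW.
Qed.

Lemma bounded_measurable_cst (c : R) : bounded_measurable (cst c).
Proof. by split; [exact: measurable_cst|exists `|c|]. Qed.

Lemma bounded_measurableD f g : bounded_measurable f -> bounded_measurable g ->
  bounded_measurable (fun w => f w + g w).
Proof.
move=> [mf [M fM]] [mg [N gN]]; split; first exact: measurable_funD.
by exists (M + N) => w; rewrite (le_trans (ler_normD _ _))// lerD.
Qed.

Lemma bounded_measurableM f g : bounded_measurable f -> bounded_measurable g ->
  bounded_measurable (fun w => f w * g w).
Proof.
move=> [mf [M fM]] [mg [N gN]]; split; first exact: measurable_funM.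
by exists (M * N) => w; rewrite normrM ler_pM.
Qed.

Lemma bounded_measurableZ (c : R) f : bounded_measurable f ->
  bounded_measurable (fun w => c * f w).
Proof. by move=> bf; apply: bounded_measurableM => //; exact: bounded_measurable_cst. Qed.

Lemma bounded_measurable_cos f : measurable_fun setT f ->
  bounded_measurable (fun w => cos (f w)).
Proof.
move=> mf; split; last by exists 1 => w; exact: cos_max.
by apply: measurableT_comp => //; apply: continuous_measurable_fun; exact: continuous_cos.
Qed.

Lemma Rintegral_cst1 (c : R) : \int[P]_w c = c.
Proof. by rewrite Rintegral_cst// [X in fine X]probability_setT mulr1. Qed.

Lemma bounded_RintegralD f g : bounded_measurable f -> bounded_measurable g ->
  \int[P]_w (f w + g w) = \int[P]_w f w + \int[P]_w g w.
Proof. by move=> bf bg; rewrite RintegralD//; exact: bounded_measurable_integrable. Qed.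

Lemma bounded_RintegralZ (c : R) f : bounded_measurable f ->
  \int[P]_w (c * f w) = c * \int[P]_w f w.
Proof. by move=> bf; rewrite RintegralZl//; exact: bounded_measurable_integrable. Qed.

Lemma bounded_EFin_Rintegral f : bounded_measurable f ->
  (\int[P]_w (f w)%:E)%E = (\int[P]_w f w)%:E.
Proof.
move=> bf; rewrite /Rintegral fineK//; apply: integrable_fin_num => //.
exact: bounded_measurable_integrable.
Qed.

(** Bounded convergence *)
Lemma bounded_Rintegral_lim (u : nat -> T -> R) f (M : R) :
  (forall n, measurable_fun setT (u n)) -> (forall n w, `|u n w| <= M) ->
  (forall w, u ^~ w @ \oo --> f w) ->
  bounded_measurable f /\
  (fun n => \int[P]_w u n w) @ \oo --> \int[P]_w f w.
Proof.
move=> mu uM uf.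
have mf : measurable_fun setT f.
  by apply: (@measurable_fun_cvg _ _ _ _ u) => // w _; exact: uf.
have bf : bounded_measurable f.
  split=> //; exists M => w.
  have uw : (fun n => `|u n w|) @ \oo --> `|f w| by apply: cvg_norm; exact: uf.
  rewrite -(cvg_lim (@Rhausdorff R) uw); apply: limr_le.
    by apply/cvg_ex; exists `|f w|.
  exact: nearW.
split=> //; apply: fine_cvg; rewrite -bounded_EFin_Rintegral//.
apply: (@dominated_cvg _ _ _ _ _ measurableT _ _ (cst M%:E)) => //.
- by move=> n; exact/measurable_EFinP.
- by move=> w _; apply/cvg_EFin; [exact: nearW|exact: uf].
- exact: (bounded_measurable_integrable (bounded_measurable_cst M)).
- by move=> n w _ /=; rewrite lee_fin.
Qed.
End Bounded.

(** * Characteristic functions of normal laws *)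

(** The variable [Y] has law N(0, s^2) under [P]. The law is tested against
    nonnegative continuous functions, which needs no integrability. *)
Definition normal_law d (T : measurableType d) (R : realType)
    (P : probability T R) (Y : T -> R) (s : R) :=
  forall f : R -> R, continuous f -> (forall x, 0 <= f x) ->
  (\int[P]_w (f (Y w))%:E = \int[centred_normal s]_x (f x)%:E)%E.

(** The characteristic function of N(0, s^2) at 1, whose imaginary part is zero *)
Definition normal_char (R : realType) (s : R) : R :=
  \int[centred_normal s]_x cos x.

Section Characteristic.
Context (R : realType).
Implicit Types (s t r theta : R).

Lemma continuous_1Dcos theta : continuous (fun x : R => 1 + cos (x + theta)).
Proof.
move=> x; apply: cvgD; first exact: cvg_cst.
apply: (@continuous_comp _ _ _ (fun x => x + theta) (@cos R)).
  by apply: cvgD; [exact: cvg_id|exact: cvg_cst].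
exact: continuous_cos.
Qed.

Lemma ge0_1Dcos theta (x : R) : 0 <= 1 + cos (x + theta).
Proof. by have := cos_geN1 (x + theta); lra. Qed.

Lemma continuous_1Dsin : continuous (fun x : R => 1 + sin x).
Proof. by move=> x; apply: cvgD; [exact: cvg_cst|exact: continuous_sin]. Qed.

Lemma bounded_measurable_sin : @bounded_measurable _ (measurableTypeR R) R (@sin R).
Proof.
split; last by exists 1 => w; exact: sin_max.
by apply: continuous_measurable_fun; exact: continuous_sin.
Qed.

Lemma integral_sin_centred_normal s : \int[centred_normal s]_x sin x = 0.
Proof.
have bs := bounded_measurable_sin.
have b1 := @bounded_measurable_cst _ (measurableTypeR R) R 1.
have s0 (x : R) : 0 <= 1 + sin x by have := sin_geN1 x; lra.
have := integral_centred_normal_reflect s continuous_1Dsin s0.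
rewrite (bounded_EFin_Rintegral _ (bounded_measurableD b1 bs)).
under eq_integral do rewrite sinN -mulN1r.
have bN := bounded_measurableZ (-1) bs.
rewrite (bounded_EFin_Rintegral _ (bounded_measurableD b1 bN)) => -[].
by rewrite !bounded_RintegralD// bounded_RintegralZ//; lra.
Qed.

Lemma normal_law_cos d (T : measurableType d) (P : probability T R)
    (Y : T -> R) s theta : measurable_fun setT Y -> normal_law P Y s ->
  \int[P]_w cos (Y w + theta) = cos theta * normal_char s.
Proof.
move=> mY lY.
have bY : bounded_measurable (fun w => cos (Y w + theta)).
  by apply: bounded_measurable_cos; exact: measurable_funD.
have b1 := @bounded_measurable_cst _ T R 1.
have := lY _ (@continuous_1Dcos theta) (ge0_1Dcos theta).
rewrite (bounded_EFin_Rintegral _ (bounded_measurableD b1 bY)).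
have b1' := @bounded_measurable_cst _ (measurableTypeR R) R 1.
have bc : @bounded_measurable _ (measurableTypeR R) R (@cos R).
  exact: bounded_measurable_cos.
have bs := bounded_measurable_sin.
have bS := bounded_measurableZ (- sin theta) bs.
have bC := bounded_measurableZ (cos theta) bc.
under [in RHS]eq_integral do rewrite cosD [X in 1 + (X - _)]mulrC
  [X in 1 + (_ - X)]mulrC -mulNr.
rewrite (bounded_EFin_Rintegral _
  (bounded_measurableD b1' (bounded_measurableD bC bS))).
move=> -[].
rewrite !bounded_RintegralD//; last exact: bounded_measurableD.
rewrite !bounded_RintegralZ// integral_sin_centred_normal mulr0 addr0 !Rintegral_cst1.
exact: addrI.
Qed.

(** The functional equation of the Gaussian characteristic function; its explicit
    form is never needed. *)
Lemma normal_char_convolution s t r : r ^+ 2 = s ^+ 2 + t ^+ 2 ->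
  normal_char r = normal_char s * normal_char t.
Proof.
move=> rE; have b1 := @bounded_measurable_cst _ (measurableTypeR R) R 1.
have bc : @bounded_measurable _ (measurableTypeR R) R (@cos R).
  exact: bounded_measurable_cos.
have bcy y : @bounded_measurable _ (measurableTypeR R) R (fun x : R => cos (x + y)).
  by apply: bounded_measurable_cos; exact: measurable_funD.
have c0 : continuous (fun x : R => 1 + cos x).
  by have := @continuous_1Dcos 0; under eq_fun do rewrite addr0.
have c_ge0 (x : R) : 0 <= 1 + cos x by have := cos_geN1 x; lra.
have := integral_centred_normal_convolution rE c0.
have inner y : (\int[centred_normal s]_x (1 + cos (x + y))%:E =
    (1 + normal_char s * cos y)%:E)%E.
  rewrite (bounded_EFin_Rintegral _ (bounded_measurableD b1 (bcy y))).
  rewrite bounded_RintegralD// Rintegral_cst1; congr (1 + _)%:E.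
  rewrite mulrC.
  by apply: (@normal_law_cos _ (measurableTypeR R) (centred_normal s) id s y).
under eq_integral do rewrite inner.
have bC := bounded_measurableZ (normal_char s) bc.
rewrite !(bounded_EFin_Rintegral _ (bounded_measurableD b1 _))//.
rewrite !bounded_RintegralD// bounded_RintegralZ// !Rintegral_cst1 => /(_ c_ge0)[].
by move=> /addrI ->.
Qed.

End Characteristic.

(** * Laws of square-integrable Gaussian variables *)

Section SquareIntegrable.
Context d (T : measurableType d) (R : realType) (P : probability T R).
Implicit Types (f g : T -> R).

(** Measurable functions with an integrable square *)
Definition square_integrable f :=
  measurable_fun setT f /\ P.-integrable setT (EFin \o (fun w => f w ^+ 2)).

Lemma square_integrableM f g : square_integrable f -> square_integrable g ->
  P.-integrable setT (EFin \o (fun w => f w * g w)).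
Proof.
move=> [mf f2] [mg g2].
apply: (@le_integrable _ _ _ P _ measurableT _ (fun w => (f w ^+ 2 + g w ^+ 2)%:E)).
- by apply/measurable_EFinP; exact: measurable_funM.
- move=> w _ /=; rewrite lee_fin (ger0_norm (addr_ge0 (sqr_ge0 _) (sqr_ge0 _))).
  rewrite ler_norml; have := sqr_ge0 (f w + g w); have := sqr_ge0 (f w - g w).
  have := sqr_ge0 (f w); have := sqr_ge0 (g w).
  by rewrite !sqrrD sqrrN mulrN; lra.
- by under eq_fun do rewrite EFinD; exact: integrableD.
Qed.

Lemma square_integrable_cst (c : R) : square_integrable (cst c).
Proof.
split; first exact: measurable_cst.
exact: (bounded_measurable_integrable P (@bounded_measurable_cst _ T R (c ^+ 2))).
Qed.

Lemma square_integrable_integrable f : square_integrable f ->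
  P.-integrable setT (EFin \o f).
Proof.
move=> f2; have := square_integrableM f2 (square_integrable_cst 1).
by apply: eq_integrable => // w _ /=; rewrite mulr1.
Qed.

Lemma square_integrableZ (c : R) f : square_integrable f ->
  square_integrable (fun w => c * f w).
Proof.
move=> [mf f2]; split; first exact: measurable_funM.
have := integrableZl measurableT (c ^+ 2) f2.
by apply: eq_integrable => // w _ /=; rewrite exprMn.
Qed.

Lemma square_integrableD f g : square_integrable f -> square_integrable g ->
  square_integrable (fun w => f w + g w).
Proof.
move=> f2 g2; split; first by apply: measurable_funD; [case: f2|case: g2].
have fg := integrableZl measurableT 2%R (square_integrableM f2 g2).
have := integrableD measurableT (integrableD measurableT f2.2 g2.2) fg.
by apply: eq_integrable => // w _ /=; congr (_%:E); ring.
Qed.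

Lemma square_integrable_sum (I : Type) (r : seq I) (F : I -> T -> R) :
  (forall i, square_integrable (F i)) ->
  square_integrable (fun w => \sum_(i <- r) F i w).
Proof.
move=> F2; elim: r => [|i r IH].
  by under eq_fun do rewrite big_nil; exact: square_integrable_cst.
by under eq_fun do rewrite big_cons; exact: square_integrableD.
Qed.

Lemma square_integrable_suml (I : Type) (r : seq I) (F : I -> T -> R) g :
  (forall i, square_integrable (F i)) -> square_integrable g ->
  \int[P]_w ((\sum_(i <- r) F i w) * g w) = \sum_(i <- r) \int[P]_w (F i w * g w).
Proof.
move=> F2 g2; elim: r => [|i r IH].
  under eq_fun do rewrite big_nil mul0r.
  by rewrite big_nil; exact: Rintegral_cst1.
rewrite big_cons -IH -RintegralD//; last 2 first.
- exact: square_integrableM.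
- by apply: square_integrableM => //; exact: square_integrable_sum.
by apply: eq_Rintegral => w _; rewrite big_cons mulrDl.
Qed.

Lemma square_integrable_Zl (c : R) f g :
  square_integrable f -> square_integrable g ->
  \int[P]_w (c * f w * g w) = c * \int[P]_w (f w * g w).
Proof.
move=> f2 g2; rewrite -RintegralZl//; last exact: square_integrableM.
by apply: eq_Rintegral => w _; rewrite mulrA.
Qed.

End SquareIntegrable.

Section GaussianLaw.
Context d (T : measurableType d) (R : realType) (P : probability T R).
Implicit Types (Y : T -> R) (m s t r : R).

Lemma ge0_integral_normal_prob_shift m s (f : R -> R) : s != 0 ->
  continuous f -> (forall x, 0 <= f x) ->
  (\int[normal_prob m s]_x (f x)%:E =
   \int[centred_normal s]_x (f (x + m))%:E)%E.
Proof.
move=> s0 cf f0; have mf := continuous_measurable_fun cf.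
have mEf : measurable_fun setT (EFin \o f) by exact/measurable_EFinP.
have mEfm : measurable_fun setT (fun x : R => (f (x + m))%:E).
  by apply/measurable_EFinP; apply: measurableT_comp => //; exact: measurable_funD.
have Ef0 x : (0 <= (f x)%:E)%E by rewrite lee_fin.
rewrite (ge0_integral_normal_prob m s mEf Ef0).
rewrite (ge0_integral_centred_normal s0 mEfm (fun x => Ef0 (x + m))).
rewrite -(@ge0_integral_affine _ 1 m)//.
- apply: eq_integral => x _; rewrite -EFinM mulr1 mul1r; congr (_ * _)%:E.
  by rewrite !normal_pdfE// /normal_fun subr0 addrK.
- move=> x; apply: continuousM; first exact: cf.
  exact: continuous_normal_pdf.
- by move=> x; rewrite mulr_ge0 ?normal_pdf_ge0.
Qed.

(** A Gaussian variable is distributed as [m] plus a centred normal variable;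
    this covers the degenerate laws, for which [s = 0]. *)
Lemma gaussian_variable_law Y : measurable_fun setT Y -> gaussian_variable P Y ->
  exists m s, forall f : R -> R, continuous f -> (forall x, 0 <= f x) ->
  (\int[P]_w (f (Y w))%:E = \int[centred_normal s]_x (f (x + m))%:E)%E.
Proof.
move=> mY [m [s PY]]; exists m, s => f cf f0.
have mf := continuous_measurable_fun cf.
have mEf : measurable_fun setT (EFin \o f) by exact/measurable_EFinP.
have mY' : measurable_fun setT (Y : T -> measurableTypeR R) by [].
transitivity (\int[pushforward P (Y : T -> measurableTypeR R)]_x (f x)%:E)%E.
  by rewrite ge0_integral_pushforward// => x _; rewrite lee_fin.
have [s0|s0] := eqVneq s 0.
  rewrite s0 integral_centred_normal0 ?add0r; last first.
    apply/measurable_EFinP; apply: measurableT_comp => //; exact: measurable_funD.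
  rewrite (@eq_measure_integral _ _ _ _ (\d_(m : measurableTypeR R))); last first.
    by move=> A mA _; have := PY A mA; rewrite s0 eqxx.
  by rewrite integral_dirac// diracT mul1e.
rewrite -ge0_integral_normal_prob_shift//.
apply: eq_measure_integral.
by move=> A mA _; have := PY A mA; rewrite (negbTE s0) => PA; exact: PA.
Qed.

Lemma centred_gaussian_law Y : square_integrable P Y -> \int[P]_w Y w = 0 ->
  gaussian_variable P Y -> exists s, normal_law P Y s.
Proof.
move=> Y2 EY0 /(gaussian_variable_law Y2.1)[m [s lY]].
exists s; suff m0 : m = 0.
  by move=> f cf f0; rewrite lY//; apply: eq_integral => x _; rewrite m0 addr0.
have csq c : continuous (fun x : R => (x + c) ^+ 2).
  move=> x; apply: (@continuous_comp _ _ _ (fun x => x + c) (fun y => y ^+ 2)).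
    by apply: cvgD; [exact: cvg_id|exact: cvg_cst].
  exact: exprn_continuous.
have sq0 c (x : R) : 0 <= (x + c) ^+ 2 by exact: sqr_ge0.
have EY c : (\int[P]_w ((Y w + c) ^+ 2)%:E =
    (\int[P]_w (Y w ^+ 2) + c ^+ 2)%:E)%E.
  have Yc2 := square_integrableD Y2 (square_integrable_cst P c).
  rewrite -[LHS]fineK; last by apply: integrable_fin_num => //; exact: Yc2.2.
  congr (_%:E); rewrite -/(Rintegral _ _ _).
  have Y1 := square_integrable_integrable Y2.
  have Z1 : P.-integrable [set: T] (EFin \o (fun w => 2 * c * Y w)).
    exact: square_integrable_integrable (square_integrableZ (2 * c) Y2).
  rewrite -[X in _ + X](Rintegral_cst1 P) -RintegralD//; [|exact: Y2.2|]; last first.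
    exact: (bounded_measurable_integrable P (@bounded_measurable_cst _ T R (c ^+ 2))).
  rewrite -[RHS]addr0 -(mulr0 (2 * c)) -EY0 -RintegralZl// -RintegralD//.
    by apply: eq_Rintegral => w _; ring.
  have := integrableD measurableT Y2.2
    (bounded_measurable_integrable P (@bounded_measurable_cst _ T R (c ^+ 2))).
  by apply: eq_integrable.
(* By symmetry of N(0, s^2), Y - m + 1 and Y - m - 1 have the same second
   moment; as Y is centred, this says that (1 - m)^2 = (1 + m)^2. *)
have := integral_centred_normal_reflect s (csq 1) (sq0 1).
have H c : (\int[centred_normal s]_x ((x + c) ^+ 2)%:E =
    (\int[P]_w (Y w ^+ 2) + (c - m) ^+ 2)%:E)%E.
  rewrite -EY (lY (fun y => (y + (c - m)) ^+ 2))//.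
  by apply: eq_integral => x _; congr (_ ^+ 2)%:E; ring.
rewrite H [X in X = _](_ : _ =
    \int[centred_normal s]_x ((x + -1) ^+ 2)%:E)%E; last first.
  by apply: eq_integral => x _; congr (_%:E); ring.
rewrite H => -[]; lra.
Qed.

Lemma integral_standard_normal_sqr_gt0 :
  (0 < \int[@centred_normal R 1]_x (x ^+ 2)%:E)%E.
Proof.
have sq0 (x : R) : (0 <= (x ^+ 2)%:E)%E by rewrite lee_fin sqr_ge0.
have msq : measurable_fun [set: R] (fun x : R => (x ^+ 2)%:E).
  by apply/measurable_EFinP; exact: measurable_funX.
rewrite lt_neqAle integral_ge0// andbT eq_sym; apply/negP => /eqP.
rewrite ge0_integral_centred_normal ?oner_neq0//.
pose g (x : R) := ((x ^+ 2)%:E * (normal_pdf 0 1 x)%:E)%E.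
have mg : measurable_fun setT g.
  apply: emeasurable_funM => //; apply/measurable_EFinP.
  exact: measurable_normal_pdf.
rewrite (_ : (\int[_]_x _)%E = (\int[@lebesgue_measure R]_x `|g x|)%E);
    last first.
  by apply: eq_integral => x _;
    rewrite gee0_abs// mule_ge0// lee_fin normal_pdf_ge0.
move=> /(ae_eq_integral_abs (@lebesgue_measure R) measurableT mg)[N [mN N0 gN]].
(* If the second moment were 0, the interval [1, 2] would be negligible. *)
have sN : `[1%R, 2%R]%classic `<=` N.
  move=> x /=; rewrite in_itv/= => /andP[x1 _]; apply: gN => /= /(_ I).
  have x0 : 0 < x := lt_le_trans ltr01 x1.
  move=> [] /eqP; rewrite mulf_eq0 expf_eq0/= (gt_eqF x0)/= normal_pdfE ?oner_neq0//.
  by rewrite mulf_eq0 (gt_eqF (expR_gt0 _)) orbF gt_eqF// normal_peak_gt0 ?oner_neq0.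
have : (@lebesgue_measure R `[1%R, 2%R] <= @lebesgue_measure R N)%E.
  by apply: le_measure; rewrite ?inE.
rewrite [leRHS]N0.
by rewrite lebesgue_measure_itv/= lte_fin ltr1n/= -EFinB lee_fin; lra.
Qed.

Lemma normal_law_sqr Y s : normal_law P Y s ->
  (\int[P]_w (Y w ^+ 2)%:E = (s ^+ 2)%:E * \int[@centred_normal R 1]_x (x ^+ 2)%:E)%E.
Proof.
move=> lY; rewrite -integral_centred_normal_sqr.
apply: (lY (fun x => x ^+ 2)) => x; last exact: sqr_ge0.
exact: exprn_continuous.
Qed.

(** If the variances add up, then so do the parameters s^2: the second moment
    of N(0, 1) is a common factor, which only has to be nonzero. *)
Lemma normal_law_scaleD (U V Z : T -> R) s t r :
  square_integrable P U -> square_integrable P V ->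
  normal_law P U s -> normal_law P V t -> normal_law P Z r ->
  (\int[P]_w (Z w ^+ 2)%:E = \int[P]_w (U w ^+ 2)%:E + \int[P]_w (V w ^+ 2)%:E)%E ->
  r ^+ 2 = s ^+ 2 + t ^+ 2.
Proof.
move=> U2 V2 /normal_law_sqr lU /normal_law_sqr lV /normal_law_sqr lZ.
have := integrable_fin_num measurableT U2.2; rewrite /= lU.
have := integrable_fin_num measurableT V2.2; rewrite /= lV.
rewrite lZ.
have := integral_standard_normal_sqr_gt0.
have z (x : R) : x ^+ 2 = 0 \/ 0 < x ^+ 2.
  by case: (eqVneq x 0) => [->|x0]; [left; rewrite expr0n|right; rewrite exprn_even_gt0].
(* An infinite second moment of N(0, 1) would force s = t = 0, and then r = 0. *)
case: (\int[centred_normal 1]_x (x ^+ 2)%:E)%E => [k|_|//].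
  rewrite lte_fin => k0 _ _ [] /eqP.
  by rewrite -mulrDl (inj_eq (mulIf (lt0r_neq0 k0))) => /eqP.
by case: (z s) => [->|s0]; case: (z t) => [->|t0]; case: (z r) => [->|r0];
  rewrite ?mul0e ?gt0_muley ?lte_fin// ?addr0.
Qed.

(** Product-to-sum reduces the claim to the functional equation of
    [normal_char], applied to [U + V] and [U - V]. *)
Lemma normal_law_cos_orthogonal (U V : T -> R) s t r r' (a b : R) :
  measurable_fun setT U -> measurable_fun setT V ->
  normal_law P U s -> normal_law P V t ->
  normal_law P (fun w => U w + V w) r -> normal_law P (fun w => U w - V w) r' ->
  r ^+ 2 = s ^+ 2 + t ^+ 2 -> r' ^+ 2 = s ^+ 2 + t ^+ 2 ->
  \int[P]_w (cos (U w + a) * cos (V w + b)) =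
  \int[P]_w cos (U w + a) * \int[P]_w cos (V w + b).
Proof.
move=> mU mV lU lV lD lB rE rE'.
have mD : measurable_fun setT (fun w => U w + V w) by exact: measurable_funD.
have mB : measurable_fun setT (fun w => U w - V w) by exact: measurable_funB.
rewrite (normal_law_cos _ mU lU) (normal_law_cos _ mV lV).
have bD : bounded_measurable (fun w => cos ((U w + V w) + (a + b))).
  by apply: bounded_measurable_cos; exact: measurable_funD.
have bB : bounded_measurable (fun w => cos ((U w - V w) + (a - b))).
  by apply: bounded_measurable_cos; exact: measurable_funD.
transitivity (\int[P]_w (2^-1 * (cos ((U w + V w) + (a + b)) +
    cos ((U w - V w) + (a - b))))).
  apply: eq_Rintegral => w _.
  have -> : U w + V w + (a + b) = (U w + a) + (V w + b) by ring.
  have -> : U w - V w + (a - b) = (U w + a) - (V w + b) by ring.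
  by rewrite (cosD (U w + a)) (cosB (U w + a)); field.
rewrite bounded_RintegralZ ?bounded_RintegralD//; last exact: bounded_measurableD.
rewrite (normal_law_cos _ mD lD) (normal_law_cos _ mB lB).
rewrite (normal_char_convolution rE) (normal_char_convolution rE') cosD cosB.
by field.
Qed.
End GaussianLaw.

(** * Approximation of the sign function by polynomials and sines *)

Section SignApproximation.
Context (R : realType).
Implicit Types x y : R.

(** An odd polynomial that maps [-1, 1] to itself with attracting fixed points
    -1 and 1: its iterates converge to the sign function on [-1, 1]. *)
Definition sign_poly x : R := (3 * x - x ^+ 3) / 2.

Lemma sign_poly_itv x : 0 <= x <= 1 -> x <= sign_poly x <= 1.
Proof.
move=> /andP[x0 x1]; rewrite /sign_poly.
have -> : (3 * x - x ^+ 3) / 2 = x + x * (1 - x) * (1 + x) / 2 by field.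
have -> : x + x * (1 - x) * (1 + x) / 2 = 1 - (1 - x) ^+ 2 * (2 + x) / 2 by field.
have h : 0 <= (1 - x) ^+ 2 * (2 + x) / 2.
  by rewrite divr_ge0 ?mulr_ge0 ?sqr_ge0//; lra.
have k : 0 <= x * (1 - x) * (1 + x) / 2.
  by rewrite divr_ge0 ?mulr_ge0//; lra.
apply/andP; split; last lra.
have -> : 1 - (1 - x) ^+ 2 * (2 + x) / 2 = x + x * (1 - x) * (1 + x) / 2 by field.
lra.
Qed.

Lemma sign_polyN x : sign_poly (- x) = - sign_poly x.
Proof. by rewrite /sign_poly; field. Qed.

Lemma normr_sign_poly x : `|x| <= 1 -> `|sign_poly x| <= 1.
Proof.
wlog x0 : x / 0 <= x => [H|].
  have [/H//|x0] := leP 0 x.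
  by rewrite -normrN => /H; rewrite oppr_ge0 ltW// sign_polyN normrN; exact.
rewrite ger0_norm// => x1; have /andP[h1 h2] := @sign_poly_itv x (introT andP (conj x0 x1)).
by rewrite ger0_norm//; lra.
Qed.

Lemma iter_sign_poly_bound x n : 0 < x <= 1 ->
  x <= iter n sign_poly x <= 1 /\ 1 - iter n sign_poly x <= (1 - x / 2) ^+ n.
Proof.
move=> /andP[x0 x1]; elim: n => [|n [/andP[IH1 IH2] IH3]] /=.
  by rewrite lexx x1 expr0; split=> //; lra.
set y := iter n sign_poly x in IH1 IH2 IH3 *.
have y01 : 0 <= y <= 1 by apply/andP; split; lra.
have /andP[h1 h2] := sign_poly_itv y01.
split; first by apply/andP; split => //; lra.
have -> : 1 - sign_poly y = (1 - y) * ((1 - y) * (2 + y) / 2).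
  by rewrite /sign_poly; field.
rewrite exprSr ler_pM//; try lra.
  by rewrite divr_ge0// mulr_ge0//; lra.
have : 0 <= y * y by rewrite mulr_ge0; lra.
by move=> yy; rewrite [leLHS](_ : _ = (2 - y - y * y) / 2); [lra|field].
Qed.

Lemma cvg_iter_sign_poly x : `|x| <= 1 ->
  (fun n => iter n sign_poly x) @ \oo --> Num.sg x.
Proof.
have pos y : 0 < y <= 1 -> (fun n => iter n sign_poly y) @ \oo --> (1 : R).
  move=> y01; have /andP[y0 y1] := y01.
  apply: (@squeeze_cvgr _ _ _ _ (fun n => 1 - (1 - y / 2) ^+ n) (fun=> 1)).
  - apply: nearW => n; have [/andP[_ h] k] := iter_sign_poly_bound n y01.
    by apply/andP; split => //; lra.
  - rewrite -[X in _ --> X]subr0; apply: cvgB; first exact: cvg_cst.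
    by apply: cvg_expr; rewrite ger0_norm; lra.
  - exact: cvg_cst.
have [x0|x0|->] := ltgtP x 0.
- rewrite ltr0_norm// => x1; rewrite ltr0_sg//.
  have -> : (fun n => iter n sign_poly x) = (fun n => - iter n sign_poly (- x)).
    apply/funext => n; elim: n => [|n /= ->]; first by rewrite /= opprK.
    by rewrite sign_polyN.
  by apply: cvgN; apply: pos; rewrite oppr_gt0 x0.
- by rewrite gtr0_norm// => x1; rewrite gtr0_sg//; apply: pos; rewrite x0.
- move=> _; rewrite sgr0.
  have -> : (fun n => iter n sign_poly 0) = (fun=> 0 : R).
    by apply/funext; elim=> // n /= ->; rewrite /sign_poly expr0n mulr0 subrr mul0r.
  exact: cvg_cst.
Qed.

(** The sign of a real number is that of a sine with a large enough period. *)
Lemma cvg_sg_sin x : (fun n => Num.sg (sin (x / n.+1%:R))) @ \oo --> Num.sg x.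
Proof.
have pos y : 0 < y -> (fun n => Num.sg (sin (y / n.+1%:R))) @ \oo --> (1 : R).
  move=> y0; apply: cvg_near_cst.
  near=> n; rewrite gtr0_sg//; apply: sin_gt0_pi; apply/andP; split.
    by rewrite divr_gt0.
  rewrite ltr_pdivrMr//.
  have h : y <= n%:R by near: n; exact: nbhs_infty_ger.
  have p2 := pi_ge2 R.
  have h0 : 0 <= n%:R :> R by exact: ler0n.
  have : 2 * n.+1%:R <= pi * n.+1%:R :> R by rewrite ler_pM2r.
  by rewrite -natr1; lra.
have [x0|x0|->] := ltgtP x 0.
- rewrite ltr0_sg//.
  have -> : (fun n => Num.sg (sin (x / n.+1%:R))) = (fun n => - Num.sg (sin (- x / n.+1%:R))).
    by apply/funext => n; rewrite mulNr sinN sgrN opprK.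
  by apply: cvgN; apply: pos; rewrite oppr_gt0.
- by rewrite gtr0_sg//; exact: pos.
- rewrite sgr0; under eq_fun do rewrite mul0r sin0 sgr0; exact: cvg_cst.
Unshelve. all: by end_near. Qed.

End SignApproximation.

(** * Events of a process are determined by its trigonometric functions *)

(** The linear combinations of the variables [X t], [t \in D]. *)
Definition linear_span (T : Type) (R : realType) (I : Type) (D : set I)
    (X : I -> T -> R) : set (T -> R) :=
  [set S | exists n (t : 'I_n -> I) (a : 'I_n -> R),
     (forall i, D (t i)) /\ S = fun w => \sum_(i < n) a i * X (t i) w].

Section LinearSpan.
Context (T : Type) (R : realType) (I : Type) (D : set I) (X : I -> T -> R).

Lemma linear_span0 : linear_span D X (cst 0).
Proof.
have f : 'I_0 -> I by case.
exists 0%N, f, (fun=> 0); split; first by case.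
by apply/funext => w; rewrite big_ord0.
Qed.

Lemma linear_span1 t : D t -> linear_span D X (X t).
Proof.
move=> Dt; exists 1%N, (fun=> t), (fun=> 1); split => //.
by apply/funext => w; rewrite big_ord1 mul1r.
Qed.

Lemma linear_spanZ (c : R) S : linear_span D X S ->
  linear_span D X (fun w => c * S w).
Proof.
move=> [n [t [a [Dt ->]]]]; exists n, t, (fun i => c * a i); split => //.
by apply/funext => w; rewrite mulr_sumr; apply: eq_bigr => i _; rewrite mulrA.
Qed.

Lemma linear_spanD S S' : linear_span D X S -> linear_span D X S' ->
  linear_span D X (fun w => S w + S' w).
Proof.
move=> [n [t [a [Dt ->]]]] [m [s [b [Ds ->]]]].
exists (n + m)%N, (fun i => match fintype.split i with inl j => t j | inr j => s j end),
  (fun i => match fintype.split i with inl j => a j | inr j => b j end); split.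
  by move=> i; case: (fintype.split i).
apply/funext => w; rewrite big_split_ord/=; congr (_ + _); apply: eq_bigr => i _.
  by rewrite (unsplitK (inl i)).
by rewrite (unsplitK (inr i)).
Qed.

Lemma linear_spanB S S' : linear_span D X S -> linear_span D X S' ->
  linear_span D X (fun w => S w - S' w).
Proof.
move=> XS XS'; have := linear_spanD XS (linear_spanZ (-1) XS').
by congr (linear_span _ _ _); apply/funext => w; rewrite mulN1r.
Qed.

Lemma linear_span_sum (J : Type) (r : seq J) (F : J -> T -> R) :
  (forall j, linear_span D X (F j)) ->
  linear_span D X (fun w => \sum_(j <- r) F j w).
Proof.
move=> FX; elim: r => [|j r IH].
  by under eq_fun do rewrite big_nil; exact: linear_span0.
by under eq_fun do rewrite big_cons; exact: linear_spanD.
Qed.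

End LinearSpan.

Lemma linear_span_sub (T : Type) (R : realType) (I J : Type) (D : set I)
    (E : set J) (X : I -> T -> R) (Y : J -> T -> R) :
  (forall t, D t -> linear_span E Y (X t)) ->
  linear_span D X `<=` linear_span E Y.
Proof.
move=> XY S [n [t [a [Dt ->]]]].
by apply: linear_span_sum => i; apply: linear_spanZ; exact: XY.
Qed.

(** Fix a bounded variable [zeta]. If it is orthogonal to all cosines of linear
    combinations of a process, then it is orthogonal to all events that depend on
    this process. *)
Section TrigonometricDetermination.
Context d (T : measurableType d) (R : realType) (P : probability T R).
Context (I : Type) (D : set I) (X : I -> T -> R).
Hypothesis mX : forall t, D t -> measurable_fun setT (X t).

Lemma measurable_linear_span S : linear_span D X S -> measurable_fun setT S.
Proof.
move=> [n [t [a [Dt ->]]]]; apply: measurable_sum => i.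
by apply: measurable_funM => //; exact: mX.
Qed.

Variable zeta : T -> R.
Hypothesis zeta_bounded : bounded_measurable zeta.

(** The bounded functions [f] such that [f * zeta] is orthogonal to all cosines of
    linear combinations of the variables [X t], with arbitrary phases. *)
Definition trig_orthogonal (f : T -> R) := bounded_measurable f /\
  forall S theta, linear_span D X S ->
    \int[P]_w (f w * (cos (S w + theta) * zeta w)) = 0.

(** The bounded functions that preserve this class by multiplication. *)
Definition trig_multiplier (u : T -> R) := bounded_measurable u /\
  forall f, trig_orthogonal f -> trig_orthogonal (fun w => f w * u w).

Let bounded_cos_zeta S theta : linear_span D X S ->
  bounded_measurable (fun w => cos (S w + theta) * zeta w).
Proof.
move=> XS; apply: bounded_measurableM => //; apply: bounded_measurable_cos.
by apply: measurable_funD => //; exact: measurable_linear_span.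
Qed.

Lemma trig_orthogonalD f g : trig_orthogonal f -> trig_orthogonal g ->
  trig_orthogonal (fun w => f w + g w).
Proof.
move=> [bf f0] [bg g0]; split; first exact: bounded_measurableD.
move=> S theta XS; have bS := bounded_cos_zeta theta XS.
under eq_Rintegral do rewrite mulrDl.
by rewrite bounded_RintegralD ?f0 ?g0 ?addr0//; exact: bounded_measurableM.
Qed.

Lemma trig_orthogonalZ (c : R) f : trig_orthogonal f ->
  trig_orthogonal (fun w => c * f w).
Proof.
move=> [bf f0]; split; first exact: bounded_measurableZ.
move=> S theta XS; have bS := bounded_cos_zeta theta XS.
under eq_Rintegral do rewrite -mulrA.
by rewrite bounded_RintegralZ ?f0 ?mulr0//; exact: bounded_measurableM.
Qed.

Lemma trig_orthogonal_lim (u : nat -> T -> R) f (M : R) :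
  (forall n, trig_orthogonal (u n)) -> (forall n w, `|u n w| <= M) ->
  (forall w, u ^~ w @ \oo --> f w) -> trig_orthogonal f.
Proof.
move=> u0 uM uf; have mu n : measurable_fun setT (u n) by case: (u0 n) => -[].
split; first by have [] := bounded_Rintegral_lim P mu uM uf.
move=> S theta XS; have [mS [N SN]] := bounded_cos_zeta theta XS.
have [|||_] := @bounded_Rintegral_lim _ _ _ P
  (fun n w => u n w * (cos (S w + theta) * zeta w))
  (fun w => f w * (cos (S w + theta) * zeta w)) (M * N).
- by move=> n; exact: measurable_funM.
- by move=> n w; rewrite normrM ler_pM.
- by move=> w; apply: cvgMl; exact: uf.
under eq_fun do rewrite (u0 _).2//.
by move=> /(cvg_lim (@Rhausdorff R)) <-; rewrite lim_cst.
Qed.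

Lemma trig_multiplier_cst (c : R) : trig_multiplier (cst c).
Proof.
split; first exact: bounded_measurable_cst.
by move=> f /(trig_orthogonalZ c); under eq_fun do rewrite mulrC.
Qed.

Lemma trig_multiplierD u v : trig_multiplier u -> trig_multiplier v ->
  trig_multiplier (fun w => u w + v w).
Proof.
move=> [bu u0] [bv v0]; split; first exact: bounded_measurableD.
move=> f f0; under eq_fun do rewrite mulrDr.
by apply: trig_orthogonalD; [exact: u0|exact: v0].
Qed.

Lemma trig_multiplierM u v : trig_multiplier u -> trig_multiplier v ->
  trig_multiplier (fun w => u w * v w).
Proof.
move=> [bu u0] [bv v0]; split; first exact: bounded_measurableM.
by move=> f f0; under eq_fun do rewrite mulrA; apply: v0; exact: u0.
Qed.

Lemma trig_multiplierZ (c : R) u : trig_multiplier u ->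
  trig_multiplier (fun w => c * u w).
Proof. by move=> mu; apply: trig_multiplierM => //; exact: trig_multiplier_cst. Qed.

Lemma trig_multiplierB u v : trig_multiplier u -> trig_multiplier v ->
  trig_multiplier (fun w => u w - v w).
Proof.
move=> mu mv; have := trig_multiplierD mu (trig_multiplierZ (-1) mv).
by under [X in trig_multiplier X -> _]eq_fun do rewrite mulN1r.
Qed.

Lemma trig_multiplier_lim (u : nat -> T -> R) f (M : R) :
  (forall n, trig_multiplier (u n)) -> (forall n w, `|u n w| <= M) ->
  (forall w, u ^~ w @ \oo --> f w) -> trig_multiplier f.
Proof.
move=> u0 uM uf; have mu n : measurable_fun setT (u n) by case: (u0 n) => -[].
split; first by have [] := bounded_Rintegral_lim P mu uM uf.
move=> g g0; have [[mg [N gN]] _] := g0.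
apply: (@trig_orthogonal_lim (fun n w => g w * u n w) _ (N * M)).
- by move=> n; exact: (u0 n).2.
- by move=> n w; rewrite normrM ler_pM.
- by move=> w; apply: cvgMr; exact: uf.
Qed.

(** A product of cosines is a sum of cosines. *)
Lemma trig_multiplier_cos S theta : linear_span D X S ->
  trig_multiplier (fun w => cos (S w + theta)).
Proof.
move=> XS; have mS := measurable_linear_span XS.
have bS : bounded_measurable (fun w => cos (S w + theta)).
  by apply: bounded_measurable_cos; exact: measurable_funD.
split => // f [bf f0]; split; first exact: bounded_measurableM.
move=> S' theta' XS'.
have XD := linear_spanD XS XS'; have XB := linear_spanB XS XS'.
transitivity (\int[P]_w (2^-1 *
    (f w * (cos (S w + S' w + (theta + theta')) * zeta w) +
     f w * (cos (S w - S' w + (theta - theta')) * zeta w)))).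
  apply: eq_Rintegral => w _.
  have -> : S w + S' w + (theta + theta') =
    (S w + theta) + (S' w + theta') by ring.
  have -> : S w - S' w + (theta - theta') =
    (S w + theta) - (S' w + theta') by ring.
  by rewrite (cosD (S w + theta)) (cosB (S w + theta)); field.
have bD := bounded_measurableM bf (bounded_cos_zeta (theta + theta') XD).
have bB := bounded_measurableM bf (bounded_cos_zeta (theta - theta') XB).
rewrite bounded_RintegralZ ?bounded_RintegralD//; last exact: bounded_measurableD.
by rewrite f0// f0// addr0 mulr0.
Qed.

Lemma trig_multiplier_sg u : trig_multiplier u -> (forall w, `|u w| <= 1) ->
  trig_multiplier (fun w => Num.sg (u w)).
Proof.
move=> mu u1.
apply: (@trig_multiplier_lim (fun n w => iter n (@sign_poly R) (u w)) _ 1).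
- elim=> [|n IH] //=.
  have := trig_multiplierZ 2^-1 (trig_multiplierB (trig_multiplierZ 3 IH)
    (trig_multiplierM IH (trig_multiplierM IH IH))).
  by congr (trig_multiplier _); apply/funext => w; rewrite /sign_poly; field.
- by move=> n w; elim: n => //= n; exact: normr_sign_poly.
- by move=> w; exact: cvg_iter_sign_poly.
Qed.

Lemma trig_multiplier_sgX t (c : R) : D t ->
  trig_multiplier (fun w => Num.sg (X t w - c)).
Proof.
move=> Dt; apply: (@trig_multiplier_lim
  (fun n w => Num.sg (sin ((X t w - c) / n.+1%:R))) _ 1).
- move=> n; apply: trig_multiplier_sg => [|w]; last exact: sin_max.
  (* The sine is a cosine with phase - pi / 2. *)
  have := @trig_multiplier_cos _ (- c / n.+1%:R - pi / 2)
    (linear_spanZ n.+1%:R^-1 (linear_span1 X Dt)).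
  congr (trig_multiplier _); apply/funext => w.
  by rewrite -cosBpihalf; congr cos; ring.
- by move=> n w; rewrite normr_sg; case: (_ != _); rewrite ?normr0 ?normr1.
- by move=> w; exact: cvg_sg_sin.
Qed.

(** The sets whose indicator is a multiplier form a sigma-algebra that contains
    the one generated by the process. *)
Lemma trig_multiplier_indic :
  process_sigma_algebra D X `<=` [set A | trig_multiplier (\1_A : T -> R)].
Proof.
set G := [set A | trig_multiplier _].
have sG : sigma_algebra setT G.
  apply/sigma_algebraP => //; split.
  - rewrite /G/=; have := trig_multiplier_cst 1.
    by congr (trig_multiplier _); apply/funext => w; rewrite indicT.
  - move=> A B BA GA GB; rewrite /G/=; have := trig_multiplierB GA GB.
    congr (trig_multiplier _); apply/funext => w; rewrite !indicE.
    rewrite in_setD; case: (boolP (w \in B)) => wB /=;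
      last by rewrite subr0 andbT.
    by rewrite andbF (_ : w \in A) ?subrr//; move: wB; rewrite !inE => /BA.
  - move=> F ndF GF; apply: (@trig_multiplier_lim (fun n => \1_(F n)) _ 1).
    + exact: GF.
    + by move=> n w; rewrite indicE; case: (_ \in _); rewrite ?normr0 ?normr1.
    + move=> w; apply: cvg_near_cst; rewrite !indicE.
      have [|wF] := pselect ((\bigcup_n F n) w).
        move=> /[dup] wF [m _ Fm]; exists m => // n /= mn.
        have /subsetPset/(_ _ Fm) Fn := ndF _ _ mn.
        by rewrite indicE !mem_set.
      apply: nearW => n; rewrite indicE memNset ?memNset// => Fn.
      by apply: wF; exists n.
  - move=> A B GA GB; rewrite /G/=; have := trig_multiplierM GA GB.
    congr (trig_multiplier _); apply/funext => w; rewrite !indicE in_setI.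
    by case: (_ \in A); case: (_ \in B); rewrite ?mulr0 ?mulr1.
apply: (smallest_sub sG) => _ [t Dt] [B mB <-]; rewrite setTI.
have [GT GC GU] := sG.
pose H : set (set R) := [set B | G (X t @^-1` B)].
have sH : sigma_algebra setT H.
  split.
  - by rewrite /H/= preimage_set0.
  - by move=> A HA; rewrite /H/= setTD preimage_setC -setTD; exact: GC.
  - by move=> F HF; rewrite /H/= preimage_bigcup; exact: GU.
suff : measurable `<=` H by exact.
have -> : (@measurable _ R) = <<s @RGenOInfty.G R >> by exact: RGenOInfty.measurableE.
apply: (smallest_sub sH) => _ [x ->]; rewrite /H/= /G/=.
(* The indicator of [X t > x] is (e ^ 2 + e) / 2 with e the sign of [X t - x]. *)
have ms := trig_multiplier_sgX x Dt.
have := trig_multiplierZ 2^-1 (trig_multiplierD (trig_multiplierM ms ms) ms).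
congr (trig_multiplier _); apply/funext => w; rewrite indicE.
have [h|h|h] := ltgtP (X t w) x.
- rewrite ltr0_sg ?subr_lt0// memNset; first by rewrite /= ?mulr0n; field.
  by rewrite /= in_itv/= andbT => /(lt_trans h); rewrite ltxx.
- rewrite gtr0_sg ?subr_gt0// mem_set; first by rewrite /= ?mulr1n; field.
  by rewrite /= in_itv/= andbT.
- rewrite h subrr sgr0 memNset; first by rewrite /= ?mulr0n; field.
  by rewrite /= in_itv/= andbT h ltxx.
Qed.

Lemma trig_determination :
  (forall S theta, linear_span D X S -> \int[P]_w (cos (S w + theta) * zeta w) = 0) ->
  forall A, process_sigma_algebra D X A ->
  measurable A /\ \int[P]_w (\1_A w * zeta w) = 0.
Proof.
move=> zeta0 A /trig_multiplier_indic[bA mA].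
have o1 : trig_orthogonal (cst 1).
  split; first exact: bounded_measurable_cst.
  by move=> S theta XS; under eq_Rintegral do rewrite mul1r; exact: zeta0.
split.
  have [mfA _] := bA; have := mfA measurableT [set 1] (measurable_set1 _).
  rewrite setTI; congr measurable; apply/seteqP; split => w /=; rewrite indicE.
    by case: (boolP (w \in A)) => [/set_mem//|_ /eqP]; rewrite eq_sym oner_eq0.
  by move=> Aw; rewrite mem_set.
(* The null combination with phase 0 has cosine 1. *)
have [_ /(_ (cst 0) 0 (linear_span0 D X))] := mA _ o1.
move=> <-; apply: eq_Rintegral => w _ /=.
by rewrite addr0 cos0 !mul1r.
Qed.

End TrigonometricDetermination.

(** * Uncorrelated Gaussian processes are independent *)

Section Uncorrelated.
Context d (T : measurableType d) (R : realType) (P : probability T R).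

Lemma square_integrableDl (f g h : T -> R) : square_integrable P f ->
  square_integrable P g -> square_integrable P h ->
  \int[P]_w ((f w + g w) * h w) = \int[P]_w (f w * h w) + \int[P]_w (g w * h w).
Proof.
move=> f2 g2 h2; rewrite -RintegralD//; try exact: square_integrableM.
by apply: eq_Rintegral => w _; rewrite mulrDl.
Qed.

Lemma square_integrableCl (f g : T -> R) :
  \int[P]_w (f w * g w) = \int[P]_w (g w * f w).
Proof. by apply: eq_Rintegral => w _; rewrite mulrC. Qed.

Lemma square_integrable_orthogonalD (f g : T -> R) : square_integrable P f ->
  square_integrable P g -> \int[P]_w (f w * g w) = 0 ->
  (\int[P]_w ((f w + g w) ^+ 2)%:E =
   \int[P]_w (f w ^+ 2)%:E + \int[P]_w (g w ^+ 2)%:E)%E.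
Proof.
move=> f2 g2 fg0; have h2 := square_integrableD f2 g2.
have E (u : T -> R) : square_integrable P u ->
    (\int[P]_w (u w ^+ 2)%:E = (\int[P]_w (u w * u w))%:E)%E.
  move=> u2; rewrite /Rintegral fineK//.
  exact: (integrable_fin_num measurableT u2.2).
rewrite !E// -EFinD; congr EFin; rewrite square_integrableDl//.
rewrite (square_integrableCl f) (square_integrableCl g) !square_integrableDl//.
by rewrite (square_integrableCl g f) fg0 addr0 add0r.
Qed.

Lemma square_integrable_orthogonalB (f g : T -> R) : square_integrable P f ->
  square_integrable P g -> \int[P]_w (f w * g w) = 0 ->
  (\int[P]_w ((f w - g w) ^+ 2)%:E =
   \int[P]_w (f w ^+ 2)%:E + \int[P]_w (g w ^+ 2)%:E)%E.
Proof.
move=> f2 g2 fg0.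
have -> : (\int[P]_w (g w ^+ 2)%:E = \int[P]_w ((-1 * g w) ^+ 2)%:E)%E.
  by apply: eq_integral => w _; rewrite mulN1r sqrrN.
rewrite -square_integrable_orthogonalD//.
- by apply: eq_integral => w _; rewrite mulN1r.
- exact: square_integrableZ.
- by rewrite square_integrableCl square_integrable_Zl// square_integrableCl fg0 mulr0.
Qed.

Lemma Rintegral_indic (A : set T) : measurable A ->
  \int[P]_w \1_A w = fine (P A).
Proof. by move=> mA; rewrite /Rintegral integral_indic// setIT. Qed.

Lemma bounded_measurable_indic (A : set T) : measurable A ->
  bounded_measurable (\1_A : T -> R).
Proof.
move=> mA; split; first exact: measurable_indic.
by exists 1 => w; rewrite indicE; case: (_ \in _); rewrite ?normr0 ?normr1.
Qed.

Context (I : Type) (D : set I) (X : I -> T -> R).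
Hypothesis gaussX : forall S, linear_span D X S -> gaussian_variable P S.
Hypothesis X2 : forall t, D t -> square_integrable P (X t).
Hypothesis EX : forall t, D t -> \int[P]_w X t w = 0.

Lemma linear_span_square_integrable S : linear_span D X S ->
  square_integrable P S.
Proof.
move=> [n [t [a [Dt ->]]]]; apply: square_integrable_sum => i.
by apply: square_integrableZ; exact: X2.
Qed.

Lemma linear_span_orthogonal f S : square_integrable P f ->
  (forall t, D t -> \int[P]_w (X t w * f w) = 0) ->
  linear_span D X S -> \int[P]_w (S w * f w) = 0.
Proof.
move=> f2 f0 [n [t [a [Dt ->]]]]; rewrite square_integrable_suml//.
  apply: big1 => i _; rewrite square_integrable_Zl// ?f0 ?mulr0//; exact: X2.
by move=> i; apply: square_integrableZ; exact: X2.
Qed.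

Lemma linear_span_centred S : linear_span D X S -> \int[P]_w S w = 0.
Proof.
move=> XS; have := @linear_span_orthogonal (cst 1) S (square_integrable_cst P 1).
under eq_Rintegral do rewrite mulr1; apply => // t Dt.
by under eq_Rintegral do rewrite mulr1; exact: EX.
Qed.

Lemma linear_span_normal_law S : linear_span D X S ->
  exists s, normal_law P S s.
Proof.
move=> XS; apply: centred_gaussian_law; last exact: gaussX.
  exact: linear_span_square_integrable.
exact: linear_span_centred.
Qed.

Variables D1 D2 : set I.
Hypotheses (D1D : D1 `<=` D) (D2D : D2 `<=` D).
Hypothesis X12 : forall s t, D1 s -> D2 t -> \int[P]_w (X s w * X t w) = 0.

Lemma linear_span_subset (E : set I) : E `<=` D ->
  linear_span E X `<=` linear_span D X.
Proof. by move=> ED; apply: linear_span_sub => t /ED; exact: linear_span1. Qed.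

(** Linear combinations [U] and [V] of two uncorrelated parts of a Gaussian process
    satisfy the product rule for cosines: [U], [V], [U + V] and [U - V] are normal
    and the last two have the sum of the variances of [U] and [V]. *)
Lemma uncorrelated_cos U V a b : linear_span D1 X U -> linear_span D2 X V ->
  \int[P]_w (cos (U w + a) * cos (V w + b)) =
  \int[P]_w cos (U w + a) * \int[P]_w cos (V w + b).
Proof.
move=> U1 V1; have U0 := linear_span_subset D1D U1.
have V0 := linear_span_subset D2D V1.
have U2 := linear_span_square_integrable U0.
have V2 := linear_span_square_integrable V0.
have UV : \int[P]_w (U w * V w) = 0.
  have [n [t [c [Dt UE]]]] := U1; rewrite UE square_integrable_suml//.
    apply: big1 => i _; rewrite square_integrable_Zl//; last exact/X2/D1D.
    rewrite square_integrableCl.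
    have [m [s [e [Ds VE]]]] := V1; rewrite VE square_integrable_suml//.
    - rewrite big1 ?mulr0// => j _.
      rewrite square_integrable_Zl//; try exact/X2/D1D.
        by rewrite square_integrableCl X12// mulr0.
      exact/X2/D2D.
    - by move=> j; apply/square_integrableZ/X2/D2D.
    - exact/X2/D1D.
  by move=> i; apply/square_integrableZ/X2/D1D.
have [s lU] := linear_span_normal_law U0.
have [t lV] := linear_span_normal_law V0.
have [r lD] := linear_span_normal_law (linear_spanD U0 V0).
have [r' lB] := linear_span_normal_law (linear_spanB U0 V0).
apply: (normal_law_cos_orthogonal _ _ U2.1 V2.1 lU lV lD lB).
  by apply: (normal_law_scaleD U2 V2 lU lV lD); exact: square_integrable_orthogonalD.
by apply: (normal_law_scaleD U2 V2 lU lV lB); exact: square_integrable_orthogonalB.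
Qed.

(** Uncorrelated parts of a Gaussian process are independent. The product rule
    passes from cosines to events one factor at a time: first with
    [zeta = cos (V + b) - E (cos (V + b))], then with [zeta = 1_A - P A]. *)
Lemma uncorrelated_independent A B : process_sigma_algebra D1 X A ->
  process_sigma_algebra D2 X B ->
  [/\ measurable A, measurable B & P (A `&` B) = (P A * P B)%E].
Proof.
move=> A1 B2.
have mX1 t : D1 t -> measurable_fun setT (X t) by move=> /D1D/X2[].
have mX2 t : D2 t -> measurable_fun setT (X t) by move=> /D2D/X2[].
have bcos E U a : E `<=` D -> linear_span E X U ->
    bounded_measurable (fun w => cos (U w + a)).
  move=> ED XU; apply: bounded_measurable_cos; apply: measurable_funD => //.
  by have [] := linear_span_square_integrable (linear_span_subset ED XU).
have A_cos V b : linear_span D2 X V -> measurable A /\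
    \int[P]_w (\1_A w * cos (V w + b)) = fine (P A) * \int[P]_w cos (V w + b).
  move=> XV; have bV := bcos _ _ b D2D XV; set c := (X in _ * X).
  have [||mA A0] := @trig_determination _ _ _ P _ D1 X mX1
      (fun w => cos (V w + b) + cst (- c) w) _ _ A A1.
  - by apply: bounded_measurableD => //; exact: bounded_measurable_cst.
  - move=> U a XU; have bU := bcos _ _ a D1D XU.
    under eq_Rintegral do rewrite mulrDr.
    rewrite bounded_RintegralD; last 2 first.
    + exact: bounded_measurableM.
    + by apply: bounded_measurableM => //; exact: bounded_measurable_cst.
    under [X in _ + X]eq_Rintegral do rewrite mulrC.
    by rewrite bounded_RintegralZ// uncorrelated_cos// mulNr mulrC subrr.
  split=> //; have b1 := bounded_measurable_indic mA.
  move: A0; under eq_Rintegral do rewrite mulrDr.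
  rewrite bounded_RintegralD; last 2 first.
  + exact: bounded_measurableM.
  + by apply: bounded_measurableM => //; exact: bounded_measurable_cst.
  under [X in _ + X]eq_Rintegral do rewrite mulrC.
  rewrite bounded_RintegralZ// Rintegral_indic// mulNr => /eqP.
  by rewrite subr_eq0 mulrC => /eqP.
have [mA _] := A_cos _ 0 (linear_span0 D2 X).
have b1 := bounded_measurable_indic mA.
have [||mB B0] := @trig_determination _ _ _ P _ D2 X mX2
      (fun w => \1_A w + cst (- fine (P A)) w) _ _ B B2.
- by apply: bounded_measurableD => //; exact: bounded_measurable_cst.
- move=> V b XV; have bV := bcos _ _ b D2D XV.
  under eq_Rintegral do rewrite mulrC mulrDl.
  rewrite bounded_RintegralD ?bounded_RintegralZ//; last 2 first.
  + exact: bounded_measurableM.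
  + exact: bounded_measurableZ.
  by rewrite (A_cos V b XV).2 mulNr subrr.
split=> //; have b2 := bounded_measurable_indic mB.
move: B0; under eq_Rintegral do rewrite mulrC mulrDl.
rewrite bounded_RintegralD ?bounded_RintegralZ//; last 2 first.
+ exact: bounded_measurableM.
+ exact: bounded_measurableZ.
rewrite Rintegral_indic// mulNr => /eqP; rewrite subr_eq0 => /eqP.
have -> : \int[P]_w (\1_A w * \1_B w) = fine (P (A `&` B)).
  rewrite -Rintegral_indic; last exact: measurableI.
  apply: eq_Rintegral => w _; rewrite !indicE in_setI.
  by case: (_ \in A); case: (_ \in B); rewrite ?mulr0 ?mulr1.
have fP (E : set T) : measurable E -> P E \is a fin_num by exact: fin_num_measure.
move=> PAB; rewrite -[LHS]fineK ?fP//; last exact: measurableI.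
by rewrite PAB EFinM !fineK ?fP.
Qed.

End Uncorrelated.

Lemma uncorrelated_independent_processes d (T : measurableType d)
    (R : realType) (P : probability T R) (K : finType) (I : Type) (D : set I)
    (X : K -> I -> T -> R) :
  (forall S, linear_span [set kt : K * I | D kt.2] (fun kt => X kt.1 kt.2) S ->
     gaussian_variable P S) ->
  (forall k t, D t -> square_integrable P (X k t)) ->
  (forall k t, D t -> \int[P]_w X k t w = 0) ->
  (forall k k' s t, k != k' -> D s -> D t -> \int[P]_w (X k s w * X k' t w) = 0) ->
  independent_processes P D X.
Proof.
move=> gX X2 EX XX L A XA.
(* Induction on the number of processes, where the process removed is compared
   with the joint process Y of the remaining ones. *)
pose Y (kt : K * I) := X kt.1 kt.2.
pose E (M : {set K}) := [set kt : K * I | kt.1 \in M /\ D kt.2].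
have sub (k : K) (M : {set K}) : k \in M ->
    process_sigma_algebra D (X k) `<=` process_sigma_algebra (E M) Y.
  move=> kM; apply: sub_sigma_algebra2; apply: bigcup_sub => t Dt.
  by apply: (bigcup_sup (i := (k, t))).
have sE (M : {set K}) : sigma_algebra setT (process_sigma_algebra (E M) Y).
  exact: smallest_sigma_algebra.
suff [] : process_sigma_algebra (E L) Y (\bigcap_(k in [set k | k \in L]) A k) /\
    P (\bigcap_(k in [set k | k \in L]) A k) = (\prod_(k in L) P (A k))%E by [].
have [n] := ubnP #|L|; elim: n => // n IH in L XA *; rewrite ltnS => Ln.
have [->|[k kL]] := set_0Vmem L.
  rewrite big_set0 (_ : \bigcap_(k in _) A k = setT); last first.
    by apply/seteqP; split => // w _ k /=; rewrite inE.
  by rewrite probability_setT; split => //; have /sigma_algebraP[] := sE (finset.set0).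
have LkL : (L :\ k) \subset L by rewrite subD1set.
have [||sC PC] := IH (L :\ k)%SET.
- by move=> j /(fintype.subsetP LkL); exact: XA.
- by rewrite (leq_trans _ Ln)// [leqRHS](cardsD1 k) kL.
set C := \bigcap_(j in _) A j in sC PC.
have -> : \bigcap_(j in [set j | j \in L]) A j = A k `&` C.
  apply/seteqP; split => [w Aw|w [Ak Cw] j /= jL].
    by split => [|j /= /(fintype.subsetP LkL)]; exact: Aw.
  by have [->//|jk] := eqVneq j k; apply: Cw; rewrite /= !inE jk.
have Ak := XA _ kL.
split.
  have [_ _ _ EI] := (sigma_algebraP (fun _ _ => @subsetT _ _)).1 (sE L).
  apply: EI; first exact: sub Ak.
  apply: sub_sigma_algebra2 sC; apply: bigcup_sub => -[j t] /= [/(fintype.subsetP LkL) jL Dt].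
  by apply: (bigcup_sup (i := (j, t))).
have [||||||||_ _ ->] := @uncorrelated_independent _ _ _ P _
    [set kt : K * I | D kt.2] Y _ _ _ (E [set k]%SET) (E (L :\ k)%SET) _ _ _ (A k) C.
- exact: gX.
- by move=> [j t] /=; exact: X2.
- by move=> [j t] /=; exact: EX.
- by move=> [j t] [].
- by move=> [j t] [].
- move=> [j s] [i t] [/= /set1P-> Ds] [/=]; rewrite !inE => /andP[ik _] Dt.
  by apply: XX => //; rewrite eq_sym.
- by apply: sub Ak; rewrite inE.
- exact: sC.
by rewrite PC (big_setD1 k kL).
Qed.

(** * Tents and ramps of a function *)

Section Ramps.
Context (R : realType) (p : nat).
Implicit Types (H K L : {set 'I_p}) (s t u : 'I_p -> R) (g : ('I_p -> R) -> R).

Lemma cube_face_proj K t : cube t -> cube (face_proj K t).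
Proof. by move=> ct j; rewrite /face_proj; case: ifP => // _; rewrite ler01 lexx. Qed.

Lemma face_cube H t : face H t -> cube t.
Proof. by move=> [u cu <-]; exact: cube_face_proj. Qed.

Lemma face_proj_face H t : face H t -> face_proj H t = t.
Proof.
move=> [u cu <-]; apply/funext => j; rewrite /face_proj.
by case: ifP => // ->.
Qed.

Lemma face_proj_setT t : face_proj [set: 'I_p]%SET t = t.
Proof. by apply/funext => j; rewrite /face_proj inE. Qed.

Lemma face_proj_sub H K t : K \subset H -> face_proj K (face_proj H t) = face_proj K t.
Proof.
move=> /fintype.subsetP KH; apply/funext => j; rewrite /face_proj.
by case: ifP => // /KH ->.
Qed.

Lemma prod_eq0 (F : 'I_p -> R) j : F j = 0 -> \prod_i F i = 0.
Proof. by move=> Fj; rewrite (bigD1 j)//= Fj mul0r. Qed.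

(** The coefficient of [g (face_proj K t)] in the H-tent of [g]: the product of
    [- t j] over [j \in H :\: K] if [K \subset H], and 0 otherwise. It is written
    as a product over all coordinates, so that sums over [K] factorize. *)
Definition tent_coef H t K : R :=
  \prod_j (if j \in K then (j \in H)%:R else if j \in H then - t j else 1).

(** The H-tent component of [g], obtained by applying to the restriction of [g] to
    the face, in each direction [j \in H], the operator that subtracts from a
    function [t j] times its value at [t j = 1]. *)
Definition tent_of H g t : R :=
  \sum_(K : {set 'I_p}) tent_coef H t K * g (face_proj K t).

Lemma tent_coef_nsub H t K : ~~ (K \subset H) -> tent_coef H t K = 0.
Proof.
by move=> /subsetPn[j jK jH]; apply: (@prod_eq0 _ j); rewrite jK (negbTE jH).
Qed.

Lemma tent_coef_face_proj H t K : tent_coef H (face_proj H t) K = tent_coef H t K.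
Proof.
apply: eq_bigr => j _; case: ifP => // _; rewrite /face_proj.
by case: (j \in H).
Qed.

Lemma sum_set_pair j (F : {set 'I_p} -> R) :
  \sum_K F K = \sum_(K : {set 'I_p} | j \notin K) (F K + F (j |: K)%SET).
Proof.
rewrite big_split/= (bigID (fun K : {set 'I_p} => j \notin K))/=; congr (_ + _).
rewrite (reindex_onto (fun K : {set 'I_p} => j |: K)%SET (fun K => K :\ j)%SET)/=.
  apply: eq_bigl => K; rewrite negbK setU11/=.
  by apply/eqP/idP => [<-|jK]; [rewrite !inE eqxx|exact: finset.setU1K].
by move=> K; rewrite negbK => jK; exact: finset.setD1K.
Qed.

Lemma tent_of_is_tent H g : (forall t, lower_boundary t -> g t = 0) ->
  is_tent H (tent_of H g).
Proof.
move=> g0 t [/face_cube ct [j jH [tj|tj]]].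
  apply: big1 => K _; have [jK|jK] := boolP (j \in K).
    rewrite g0 ?mulr0//; split; first exact: cube_face_proj.
    by exists j; rewrite /face_proj jK.
  by rewrite /tent_coef (@prod_eq0 _ j) ?mul0r// (negbTE jK) jH tj oppr0.
(* The terms of K and of j |: K cancel out since t j = 1. *)
rewrite /tent_of (sum_set_pair j); apply: big1 => K jK.
have -> : face_proj (j |: K)%SET t = face_proj K t.
  apply/funext => i; rewrite /face_proj !inE.
  by have [->|//] := eqVneq i j; rewrite (negbTE jK) tj.
rewrite -mulrDl; apply/eqP; rewrite mulf_eq0; apply/orP; left; apply/eqP.
rewrite /tent_coef (bigD1 j)//= [X in _ + X](bigD1 j)//=.
rewrite (negbTE jK) jH tj !inE eqxx/= (_ : \prod_(_ < _ | _) _ =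
    \prod_(i < p | i != j) (if i \in (j |: K)%SET then (i \in H)%:R
      else if i \in H then - t i else 1)).
  by rewrite mulN1r mul1r addNr.
by apply: eq_bigr => i ij; rewrite !inE (negbTE ij).
Qed.

Lemma sum_ramp_tent_of g t : \sum_(H : {set 'I_p}) ramp H (tent_of H g) t = g t.
Proof.
transitivity (\sum_(K : {set 'I_p}) g (face_proj K t) *
    \prod_j ((if j \in K then 1 else - t j) + (if j \in K then 0 else t j))).
  under [RHS]eq_bigr do rewrite bigA_distr mulr_sumr.
  rewrite exchange_big/=; apply: eq_bigr => H _.
  rewrite /ramp /tent_of mulr_sumr; apply: eq_bigr => K _.
  rewrite tent_coef_face_proj.
  have [KH|KH] := boolP (K \subset H); last first.
    rewrite (tent_coef_nsub _ KH) mul0r mulr0.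
    have /subsetPn[j jK jH] := KH.
    by rewrite (@prod_eq0 _ j) ?mulr0// (negbTE jH) jK.
  rewrite face_proj_sub// mulrA [RHS]mulrC; congr (_ * _).
  rewrite big_mkcond/= -big_split/=; apply: eq_bigr => j _.
  have [jH|jH] := boolP (j \in H); case: (boolP (j \in K)) => jK;
    rewrite ?mulr1 ?mul1r//.
  by have := fintype.subsetP KH _ jK; rewrite (negbTE jH).
(* Only the term of the full set of coordinates survives. *)
rewrite (bigD1 [set: 'I_p]%SET)//= [X in _ + X]big1 => [|K].
  by rewrite face_proj_setT big1 ?mulr1 ?addr0// => j _; rewrite inE addr0.
rewrite -finset.subTset => /subsetPn[j _ jK].
by rewrite (@prod_eq0 _ j) ?mulr0// (negbTE jK) addNr.
Qed.

Lemma ramp_decomposition_tent_of g : (forall t, lower_boundary t -> g t = 0) ->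
  ramp_decomposition g (fun H => tent_of H g).
Proof.
by move=> g0; split => [H|t _]; [exact: tent_of_is_tent|rewrite sum_ramp_tent_of].
Qed.

(** Taking H-tents kills the K-ramps with [K != H] and inverts the passage from
    H-tents to H-ramps. *)
Lemma tent_of_ramp H K g t : is_tent K g -> cube t ->
  tent_of H (ramp K g) t = (H == K)%:R * g (face_proj K t).
Proof.
move=> gt ct.
(* If K is not a subset of L, the point lies on the boundary of the K-face. *)
have gE L : g (face_proj K (face_proj L t)) =
    (\prod_j (if j \in L then 1 else (j \notin K)%:R)) * g (face_proj K t).
  have [KL|] := boolP (K \subset L).
    rewrite face_proj_sub// big1 ?mul1r// => j _.
    case: ifP => // jL; have [/(fintype.subsetP KL)|//] := boolP (j \in K).
    by rewrite jL.
  move=> /subsetPn[j jK jL]; rewrite (@prod_eq0 _ j) ?(negbTE jL) ?jK// mul0r.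
  apply: gt; split; first by exists (face_proj L t) => //; exact: cube_face_proj.
  by exists j => //; right; rewrite /face_proj jK (negbTE jL).
transitivity ((\prod_j ((j \in H)%:R * (if j \in K then 1 else t j) +
    (if j \in H then - t j else 1) * (j \notin K)%:R)) * g (face_proj K t)).
  rewrite bigA_distr mulr_suml; apply: eq_bigr => L _.
  rewrite /ramp gE !mulrA; congr (_ * _).
  rewrite /tent_coef [X in _ * X * _]big_mkcond/= -!big_split/=.
  apply: eq_bigr => j _; rewrite /face_proj.
  by case: (j \in L); case: (j \in K); rewrite ?mulr1.
congr (_ * _); have [<-|HK] := eqVneq H K.
  rewrite big1// => j _.
  by case: (j \in H); rewrite /= ?mulr1 ?mulr0 ?mul0r ?addr0 ?add0r.
move: HK; rewrite finset.eqEsubset negb_and => /orP[] /subsetPn[j j1 j2];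
  apply: (@prod_eq0 _ j); rewrite j1 (negbTE j2) /=.
  by rewrite mul1r mulr1 subrr.
by rewrite mul0r mulr0 addr0.
Qed.

Lemma ramp_decomposition_unique g (T : {set 'I_p} -> ('I_p -> R) -> R) H t :
  ramp_decomposition g T -> face H t -> T H t = tent_of H g t.
Proof.
move=> [tT gT] Ht; have ct := face_cube Ht.
transitivity (\sum_(K : {set 'I_p}) tent_of H (ramp K (T K)) t).
  under eq_bigr do rewrite tent_of_ramp//.
  rewrite (bigD1 H)//= eqxx mul1r face_proj_face// big1 ?addr0// => K.
  by rewrite eq_sym => /negbTE ->; rewrite mul0r.
rewrite exchange_big/=; apply: eq_bigr => L _.
by rewrite -mulr_sumr gT//; exact: cube_face_proj.
Qed.

(** The covariance of the H-tent component of a sheet at [s] and the sheet at [u] *)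
Lemma tent_covariance H s u : cube s -> cube u ->
  \sum_(K : {set 'I_p}) tent_coef H s K *
    \prod_j Num.min (face_proj K s j) (u j) =
  \prod_j (if j \in H then Num.min (s j) (u j) - s j * u j else u j).
Proof.
move=> cs cu.
transitivity (\prod_j ((j \in H)%:R * Num.min (s j) (u j) +
   (if j \in H then - s j else 1) * u j)).
  rewrite bigA_distr; apply: eq_bigr => K _; rewrite -big_split/=.
  apply: eq_bigr => j _; rewrite /face_proj; case: ifP => // _.
  by rewrite (min_idPr _)//; have /andP[] := cu j.
apply: eq_bigr => j _; case: (j \in H); first by rewrite mul1r mulNr.
by rewrite mul0r add0r mul1r.
Qed.

(** The covariance of the H-tent and K-tent components of a sheet factorizes over
    the coordinates, and has a null factor when [H] and [K] differ. *)
Lemma tent_tent_covariance H K s t : cube s -> cube t ->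
  \sum_(L : {set 'I_p}) tent_coef K t L *
    \prod_j (if j \in H then Num.min (s j) (face_proj L t j) - s j * face_proj L t j
             else face_proj L t j) =
  (H == K)%:R * \prod_(j in H) (Num.min (s j) (t j) - s j * t j).
Proof.
move=> cs ct.
transitivity (\prod_j ((j \in K)%:R *
     (if j \in H then Num.min (s j) (t j) - s j * t j else t j) +
   (if j \in K then - t j else 1) * (j \notin H)%:R)).
  rewrite bigA_distr; apply: eq_bigr => L _; rewrite -big_split/=.
  apply: eq_bigr => j _; rewrite /face_proj; case: ifP => // _.
  case: (j \in H) => //=; rewrite (min_idPl _) ?mulr1 ?subrr ?mulr0//.
  by have /andP[] := cs j.
have [<-|HK] := eqVneq H K.
  rewrite mul1r [RHS]big_mkcond/=; apply: eq_bigr => j _.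
  by case: (j \in H); rewrite /= ?mulr1 ?mulr0 ?mul0r ?mul1r ?addr0 ?add0r.
rewrite mul0r.
move: HK; rewrite finset.eqEsubset negb_and => /orP[] /subsetPn[j j1 j2];
  apply: (@prod_eq0 _ j); rewrite j1 (negbTE j2) /=.
  by rewrite mul0r mulr0 addr0.
by rewrite mul1r mulr1 subrr.
Qed.

End Ramps.

(** * Almost sure equality *)

Section AlmostSureEquality.
Context d (T : measurableType d) (R : realType) (P : probability T R).
Implicit Types (f g : T -> R).

Lemma ae_eq_integral_EFin f g : measurable_fun setT f -> measurable_fun setT g ->
  {ae P, forall w, f w = g w} ->
  (\int[P]_w (f w)%:E = \int[P]_w (g w)%:E)%E.
Proof.
move=> mf mg fg; apply: ae_eq_integral => //.
- exact/measurable_EFinP.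
- exact/measurable_EFinP.
- by apply: filterS fg => w /= -> _.
Qed.

Lemma ae_eq_expectation f g : measurable_fun setT f -> measurable_fun setT g ->
  {ae P, forall w, f w = g w} -> ('E_P[f] = 'E_P[g])%E.
Proof. by move=> mf mg fg; rewrite unlock; exact: ae_eq_integral_EFin. Qed.

Lemma ae_eq_Rintegral f g : measurable_fun setT f -> measurable_fun setT g ->
  {ae P, forall w, f w = g w} -> \int[P]_w f w = \int[P]_w g w.
Proof. by move=> mf mg fg; rewrite /Rintegral (ae_eq_integral_EFin mf mg fg). Qed.

Lemma ae_eq_gaussian_variable f g : measurable_fun setT f ->
  measurable_fun setT g -> {ae P, forall w, f w = g w} ->
  gaussian_variable P g -> gaussian_variable P f.
Proof.
move=> mf mg fg [m [s gP]]; exists m, s => B mB; rewrite -gP//.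
have mE (h : T -> R) : measurable_fun setT h -> measurable (h @^-1` B).
  by move=> mh; rewrite -[X in measurable X]setTI; apply: mh.
rewrite -!expectation_indic; try exact: mE.
apply: ae_eq_expectation; try exact/measurable_indic/mE.
apply: filterS fg => w /= fgw; rewrite !indicE.
have -> // : (w \in f @^-1` B) = (w \in g @^-1` B).
by apply/idP/idP; rewrite !inE /= fgw.
Qed.

Lemma ae_eq_square_integrable f g : measurable_fun setT f ->
  {ae P, forall w, f w = g w} -> square_integrable P g -> square_integrable P f.
Proof.
move=> mf fg [mg g2]; split=> //.
apply/integrableP; split; first by apply/measurable_EFinP; exact: measurable_funX.
have /integrableP[_] := g2; apply: le_lt_trans; rewrite le_eqVlt; apply/orP; left.
apply/eqP; apply: ae_eq_integral => //.
- by apply: measurableT_comp => //; apply/measurable_EFinP; exact: measurable_funX.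
- by apply: measurableT_comp => //; apply/measurable_EFinP; exact: measurable_funX.
- by apply: filterS fg => w /= -> _.
Qed.

Lemma square_integrable_expectation f g : square_integrable P f ->
  square_integrable P g ->
  ('E_P[fun w => (f w * g w)%R] = (\int[P]_w (f w * g w))%:E)%E.
Proof.
move=> f2 g2; rewrite unlock /Rintegral fineK//.
exact: (integrable_fin_num measurableT (square_integrableM f2 g2)).
Qed.

End AlmostSureEquality.

(** * The tents of a Brownian sheet *)

Section Sheet.
Context (d : measure_display) (Omega : measurableType d) (R : realType)
  (P : probability Omega R) (p : nat) (W : ('I_p -> R) -> {RV P >-> R}).
Hypothesis W_sheet : brownian_sheet W.
Implicit Types (H K : {set 'I_p}) (s t u : 'I_p -> R).

(* The sheet as a family of plain functions *)
Let WW (t : 'I_p -> R) : Omega -> R := W t.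

Lemma sheet_square_integrable t : cube t -> square_integrable P (W t).
Proof.
move=> ct; split; first exact: measurable_funPT.
have [_ /(_ t t ct ct)] := W_sheet; rewrite unlock => EW.
apply/integrableP; split.
  by apply/measurable_EFinP/measurable_funX; exact: measurable_funPT.
rewrite (_ : (\int[P]_w _)%E = (\int[P]_w (W t w * W t w)%:E)%E) ?EW ?ltry//.
by rewrite -EW; apply: eq_integral => w _; rewrite gee0_abs ?lee_fin ?sqr_ge0.
Qed.

Lemma sheet_centred t : cube t -> \int[P]_w W t w = 0.
Proof.
move=> ct; have [[_ EW] _] := W_sheet; have := EW t ct.
by rewrite unlock /Rintegral => ->.
Qed.

Lemma sheet_covariance s t : cube s -> cube t ->
  \int[P]_w (W s w * W t w) = \prod_j Num.min (s j) (t j).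
Proof.
by move=> cs ct; have [_ /(_ s t cs ct)] := W_sheet; rewrite unlock /Rintegral => ->.
Qed.

Lemma sheet_gaussian S : linear_span (@cube R p) WW S -> gaussian_variable P S.
Proof.
by move=> [n [t [a [Dt ->]]]]; have [[gW _] _] := W_sheet; exact: gW.
Qed.

(** The H-tent component of the sheet *)
Definition sheet_tent H t : Omega -> R := fun w => tent_of H (fun u => W u w) t.

Lemma sheet_tent_measurable H t : measurable_fun setT (sheet_tent H t).
Proof.
by apply: measurable_sum => K; exact: measurable_funM.
Qed.

Lemma sheet_tent_linear_span H t : cube t ->
  linear_span (@cube R p) WW (sheet_tent H t).
Proof.
move=> ct; apply: linear_span_sum => K; apply: linear_spanZ.
by apply: (linear_span1 WW); exact: cube_face_proj.
Qed.

Lemma sheet_tent_square_integrable H t : cube t ->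
  square_integrable P (sheet_tent H t).
Proof.
move=> /(sheet_tent_linear_span H); apply: linear_span_square_integrable.
exact: sheet_square_integrable.
Qed.

Lemma sheet_tent_centred H t : cube t -> \int[P]_w sheet_tent H t w = 0.
Proof.
move=> /(sheet_tent_linear_span H); apply: linear_span_centred.
- exact: sheet_square_integrable.
- exact: sheet_centred.
Qed.

Lemma sheet_tent_covariance H K s t : cube s -> cube t ->
  \int[P]_w (sheet_tent H s w * sheet_tent K t w) =
  (H == K)%:R * \prod_(j in H) (Num.min (s j) (t j) - s j * t j).
Proof.
move=> cs ct.
have W2 L u : cube u -> square_integrable P (W (face_proj L u)).
  by move=> cu; exact/sheet_square_integrable/cube_face_proj.
have HW u : cube u -> \int[P]_w (sheet_tent H s w * W u w) =
    \prod_j (if j \in H then Num.min (s j) (u j) - s j * u j else u j).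
  move=> cu; rewrite -tent_covariance//.
  rewrite [LHS]square_integrable_suml.
  - apply: eq_bigr => L _; rewrite square_integrable_Zl ?sheet_covariance//.
    + exact: cube_face_proj.
    + exact: W2.
    + exact: sheet_square_integrable.
  - by move=> L; apply: square_integrableZ; exact: W2.
  - exact: sheet_square_integrable.
rewrite square_integrableCl [LHS]square_integrable_suml; last 2 first.
- by move=> L; apply: square_integrableZ; exact: W2.
- exact: sheet_tent_square_integrable.
rewrite -tent_tent_covariance//; apply: eq_bigr => L _.
rewrite square_integrable_Zl; last 2 first.
- exact: W2.
- exact: sheet_tent_square_integrable.
by rewrite square_integrableCl HW//; exact: cube_face_proj.
Qed.

(** Any decomposition of the sheet into ramps of random tents coincides almost
    surely with the explicit one, so that it has the same finite-dimensional
    laws. *)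
Variable T : {set 'I_p} -> ('I_p -> R) -> {RV P >-> R}.
Hypothesis T_dec : as_ramp_decomposition P (fun t => W t) (fun H t => T H t).

Lemma decomposition_ae_sheet_tent :
  {ae P, forall w, forall H t, face H t -> T H t w = sheet_tent H t w}.
Proof.
apply: filterS T_dec => w dec H t Ht.
exact: (ramp_decomposition_unique dec).
Qed.

Lemma decomposition_tent_ae H t : face H t ->
  {ae P, forall w, T H t w = sheet_tent H t w}.
Proof.
by move=> Ht; apply: filterS decomposition_ae_sheet_tent => w; exact.
Qed.

Lemma decomposition_brownian_tent H : brownian_tent H (T H).
Proof.
have mT t : measurable_fun setT (T H t) by exact: measurable_funPT.
split; first split.
- move=> n t a Ht.
  apply: (@ae_eq_gaussian_variable _ _ _ _ _
    (fun w => \sum_(i < n) a i * sheet_tent H (t i) w)).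
  + by apply: measurable_sum => i; exact: measurable_funM.
  + apply: measurable_sum => i; apply: measurable_funM => //.
    exact: sheet_tent_measurable.
  + apply: filterS decomposition_ae_sheet_tent => w Tw.
    by apply: eq_bigr => i _; rewrite Tw.
  + apply: sheet_gaussian; apply: linear_span_sum => i; apply: linear_spanZ.
    by apply: sheet_tent_linear_span; exact: face_cube.
- move=> t Ht.
  rewrite (ae_eq_expectation _ _ (decomposition_tent_ae Ht))//; last first.
    exact: sheet_tent_measurable.
  have ct := face_cube Ht.
  rewrite unlock -[LHS]fineK; first by congr EFin; exact: sheet_tent_centred.
  apply: integrable_fin_num => //; apply: square_integrable_integrable.
  exact: sheet_tent_square_integrable.
- move=> s t Hs Ht; have cs := face_cube Hs; have ct := face_cube Ht.
  rewrite (@ae_eq_expectation _ _ _ _ _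
    (fun w => sheet_tent H s w * sheet_tent H t w)).
  + rewrite square_integrable_expectation; try exact: sheet_tent_square_integrable.
    by rewrite sheet_tent_covariance// eqxx mul1r.
  + exact: measurable_funM.
  + by apply: measurable_funM; exact: sheet_tent_measurable.
  + by apply: filterS decomposition_ae_sheet_tent => w Tw; rewrite !Tw.
Qed.

Lemma decomposition_independent :
  independent_processes P (@cube R p) (fun H t w => ramp H (fun u => T H u w) t).
Proof.
pose RT H t (w : Omega) := ramp H (fun u => T H u w) t.
pose RW H t (w : Omega) :=
  (\prod_(j | j \notin H) t j) * sheet_tent H (face_proj H t) w.
have mRT H t : measurable_fun setT (RT H t).
  by apply: measurable_funM => //; exact: measurable_funPT.
have mRW H t : measurable_fun setT (RW H t).
  by apply: measurable_funM => //; exact: sheet_tent_measurable.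
have RTW : {ae P, forall w, forall H t, cube t -> RT H t w = RW H t w}.
  apply: filterS decomposition_ae_sheet_tent => w Tw H t ct.
  by rewrite /RT /RW /ramp Tw//; exists t.
have RTW1 H t : cube t -> {ae P, forall w, RT H t w = RW H t w}.
  by move=> ct; apply: filterS RTW => w; exact.
have RW2 H t : cube t -> square_integrable P (RW H t).
  move=> ct; apply: square_integrableZ.
  by apply: sheet_tent_square_integrable; exact: cube_face_proj.
have RWS H t : cube t -> linear_span (@cube R p) WW (RW H t).
  move=> ct; apply: linear_spanZ; apply: sheet_tent_linear_span.
  exact: cube_face_proj.
apply: (@uncorrelated_independent_processes _ _ _ P _ _ _ RT).
- move=> S [n [Ht [a [/= Dt ->]]]].
  apply: (@ae_eq_gaussian_variable _ _ _ _ _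
    (fun w => \sum_(i < n) a i * RW (Ht i).1 (Ht i).2 w)).
  + by apply: measurable_sum => i; exact: measurable_funM.
  + by apply: measurable_sum => i; exact: measurable_funM.
  + by apply: filterS RTW => w Rw; apply: eq_bigr => i _; rewrite Rw//; exact: Dt.
  + apply: sheet_gaussian; apply: linear_span_sum => i; apply: linear_spanZ.
    exact: RWS (Dt i).
- move=> H t ct; apply: (ae_eq_square_integrable _ (RTW1 H t ct)) => //.
  exact: RW2.
- move=> H t ct; rewrite (ae_eq_Rintegral _ _ (RTW1 H t ct))//.
  apply: (linear_span_centred _ _ (RWS H t ct)).
    exact: sheet_square_integrable.
  exact: sheet_centred.
- move=> H K s t HK cs ct.
  rewrite (@ae_eq_Rintegral _ _ _ _ _ (fun w => RW H s w * RW K t w)).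
  + have s2 := sheet_tent_square_integrable H (cube_face_proj H cs).
    rewrite square_integrable_Zl//; last exact: RW2.
    rewrite square_integrableCl square_integrable_Zl//; last first.
      by apply: sheet_tent_square_integrable; exact: cube_face_proj.
    rewrite square_integrableCl sheet_tent_covariance; try exact: cube_face_proj.
    by rewrite (negbTE HK) mul0r !mulr0.
  + exact: measurable_funM.
  + exact: measurable_funM.
  + by apply: filterS RTW => w Rw; rewrite !Rw.
Qed.

End Sheet.

Theorem corollary1 (d : measure_display) (Omega : measurableType d)
    (R : realType) (P : probability Omega R) (p : nat) (p_ge1 : (1 <= p)%N)
    (W : ('I_p -> R) -> {RV P >-> R})
    (W_sheet : brownian_sheet W)
    (W_vanish : {ae P, forall w, forall t, lower_boundary t -> W t w = 0}) :
  (* existence of the decomposition, by random variables *)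
  (exists T : {set 'I_p} -> ('I_p -> R) -> {RV P >-> R},
     as_ramp_decomposition P (fun t => W t) (fun H t => T H t)) /\
  (* uniqueness, almost surely *)
  (forall T T' : {set 'I_p} -> ('I_p -> R) -> Omega -> R,
     as_ramp_decomposition P (fun t => W t) T ->
     as_ramp_decomposition P (fun t => W t) T' ->
     {ae P, forall w, forall H t, face H t -> T H t w = T' H t w}) /\
  (* the ramps are independent and Brownian *)
  (forall T : {set 'I_p} -> ('I_p -> R) -> {RV P >-> R},
     as_ramp_decomposition P (fun t => W t) (fun H t => T H t) ->
     independent_processes P (@cube R p)
       (fun H t w => ramp H (fun u => T H u w) t) /\
     (forall H : {set 'I_p}, brownian_tent H (T H))).
Proof.
split; [|split].
- have mT H t := isMeasurableFun.Build _ _ _ _ _ (sheet_tent_measurable W H t).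
  pose T H t : {RV P >-> R} := HB.pack (sheet_tent W H t) (mT H t).
  exists T; apply: filterS W_vanish => w Ww.
  exact: (ramp_decomposition_tent_of Ww).
- move=> T T' dec dec'; apply: filterS2 dec dec' => w dec dec' H t Ht.
  by rewrite (ramp_decomposition_unique dec Ht) (ramp_decomposition_unique dec' Ht).
- move=> T dec; split.
    exact: decomposition_independent W_sheet _ dec.
  by move=> H; exact: decomposition_brownian_tent W_sheet _ dec H.
Qed.
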